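(* Let $s$ be an integer such that $3s^2-4s+4$ is a perfect square. Let $K_s$ be the splitting field over $\mathbb{Q}$ of $$F_s(t)= t^4 + (4s^3 - 4s^2 + 8s - 4)t^3 + (-6s^2 - 6)t^2 + 4t + 1.$$ Then $\mathrm{Gal}(K_s/\mathbb{Q})$ is cyclic of order 4. Moreover, if $s^2+2$ is squarefree and $s\neq 0$, then $\pm 1$ together with the four roots of $F_s(t)$ generate either the full unit group of the ring of algebraic integers of $K_s$, or a subgroup of index $5$ in it. *)

(* Defs.v *)
From HB Require Import structures.
From mathcomp Require Import all_boot all_order all_algebra all_fingroup all_solvable all_field.
Set Implicit Arguments. Unset Strict Implicit. Unset Printing Implicit Defensive.
Import Order.TTheory GRing.Theory Num.Theory.
Local Open Scope ring_scope.

Definition squarefree (n : nat) : Prop := forall d : nat, (d * d %| n)%N -> d = 1%N.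

Definition Fs (s : int) : {poly rat} :=
  'X^4 + ((4 * s ^+ 3 - 4 * s ^+ 2 + 8 * s - 4)%:~R)%:P * 'X^3
  + ((- 6 * s ^+ 2 - 6)%:~R)%:P * 'X^2 + 4%:P * 'X + 1.

Definition alg_integer (L : fieldExtType rat) (x : L) : Prop :=
  exists p : {poly int}, p \is monic /\ root (map_poly (fun z : int => z%:~R) p) x.

Definition int_unit (L : fieldExtType rat) (E : {vspace L}) (x : L) : Prop :=
  [/\ x \in E, x != 0, alg_integer x & alg_integer x^-1].

Definition in_gen_group (L : fieldExtType rat) (gens : seq L) (v : L) : Prop :=
  exists ks : seq int, size ks = size gens /\
    v = \prod_(i < size gens) (gens`_i ^ ks`_i).

(* H has index n in U (both given as predicates, H a subgroup of U):
   there are n coset representatives u_0,...,u_{n-1} in U such that every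
   element of U lies in exactly one coset u_i H. *)
Definition has_index (L : fieldExtType rat) (U H : L -> Prop) (n : nat) : Prop :=
  exists reps : 'I_n -> L,
    (forall i, U (reps i)) /\
    (forall u, U u -> exists i, exists2 h, H h & u = reps i * h) /\
    (forall i j, (exists2 h, H h & reps i = reps j * h) -> i = j).

(* Main.v *)
(** Put D = s^2 + 2, w^2 = D, e0 = s^2 + 1 + s w, p = s^3 - s^2 + 2 s - 1 and
    q = s^2 - s + 1.  Over k = Q(w) the quartic factors as
      F_s = (t^2 + 2 (p + q w) t - e0) (t^2 + 2 (p - q w) t - e0'),
    and the two discriminants have product 16 m^2 D with
    m^2 = 3 s^2 - 4 s + 4.  Hence an automorphism g with g w = - w has order 4
    and generates the Galois group.

    Every unit of k is +-e0^n, and a root r has relative norm - e0, so modulo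
    powers of r every unit lies in the group E1 of units of relative norm +-1,
    a Z[i]-module modulo +-1 with i acting as g.  Measure x in E1 by
    Q(x) = ln^2 |x| + ln^2 |g x|.  If x <> +-1, then x + g^2 x = a + b w with
    b even and nonzero, which forces Q(x) >= z^2 for z = ln (2 |s|).  So E1 has
    a Z[i]-generator y, obtained by Euclidean division.  For rho = r * g r one
    computes Q(rho) < 9 z^2; writing rho = +- y^(c + d i) gives c^2 + d^2 < 9.
    Finally c + d is odd, because rho is not +- x * g x with x in E1 (compare
    relative norms), so the index c^2 + d^2 is 1 or 5. *)
Require Import Defs.
From HB Require Import structures.
From mathcomp Require Import all_boot all_order all_algebra all_fingroup all_solvable all_field.
From mathcomp Require Import ring lra zify.
From mathcomp Require Import reals exp Rstruct.
Set Implicit Arguments. Unset Strict Implicit. Unset Printing Implicit Defensive.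
Import Order.TTheory GRing.Theory Num.Theory.
Local Open Scope ring_scope.

(** * Integer arithmetic *)

(** The map x -> ln |x| - i ln |g x| is Z[i]-linear on E1, because g^2 x = +-1/x, and Q is its
    squared absolute value. Rounding a Gaussian quotient leaves a remainder whose Q is at most half
    of Q(y), so finite generation of the units is never assumed: a positive lower bound for Q
    suffices. The constants fit tightly. Since 4 divides s, D = 2 mod 4. With D squarefree this
    makes Z[w] the ring of integers of k, and it forces the parity of b, which raises |b| >= 1 to
    |b| >= 2 and the lower bound from about ln |s| to ln (2 |s|). On the other side, Q(rho) is half
    the sum of ln^2 |r / g^2 r| and its conjugate. One of the two ratios is bounded, together with
    its inverse, by (2 |s|)^4 and the other by 24 <= 2 |s|, as |s| >= 12; hence Q(rho) <= (16 + 1)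
    z^2 / 2. Below 9, only 1 and 5 are odd sums of two squares. Most sign ambiguities of units are
    removed by comparing squares. *)

Lemma family_dvd4 (s m : int) : 3 * s ^+ 2 - 4 * s + 4 = m ^+ 2 ->
  exists t : int, s = 4 * t.
Proof.
move=> h.
have /orP[|/eqP s0] : ((s %% 4)%Z == 0) || ((s %% 4)%Z != 0) by case: eqP.
  move=> /eqP s0; exists (s %/ 4)%Z; lia.
have : (m %% 4)%Z = 0 \/ (m %% 4)%Z = 1 \/ (m %% 4)%Z = 2 \/ (m %% 4)%Z = 3 by lia.
have : (s %% 4)%Z = 1 \/ (s %% 4)%Z = 2 \/ (s %% 4)%Z = 3 by lia.
have := divz_eq s 4; have := divz_eq m 4.
move: (s %/ 4)%Z (m %/ 4)%Z => u v hm hs.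
(* Odd s makes the left-hand side 3 mod 4. If s = 2a with a odd, then m^2 / 4 = 3 a^2 - 2 a + 1 is 2
   mod 4. *)
move=> [|[|]] e; rewrite e in hs; move=> [|[|[|]]] e'; rewrite e' in hm; subst s m; exfalso; clear -h.
all: try nia.
all: lia.
Qed.

Lemma family_even (s m : int) : 3 * s ^+ 2 - 4 * s + 4 = m ^+ 2 ->
  exists t : int, s = 2 * t.
Proof. by case/family_dvd4 => t ->; exists (2 * t); ring. Qed.

(** With s = 4t only t = +-1, +-2 remain to be excluded: s = 4 gives D = 18, divisible by 9, and s =
    -4, 8, -8 give 68, 164, 228, which are not squares. *)
Lemma family_ge12 (s m : int) : 3 * s ^+ 2 - 4 * s + 4 = m ^+ 2 ->
  squarefree (absz (s ^+ 2 + 2)) -> s != 0 -> 12 <= `|s|.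
Proof.
move=> h sqf s0; case: (family_dvd4 h) => t st.
have [t3|t3] := lerP 3 `|t|; first by lia.
have e : (2 * (6 * t ^+ 2 - 2 * t) + 1) * 4 = m ^+ 2 by rewrite -h st; ring.
have : t = 1 \/ t = -1 \/ t = 2 \/ t = -2 by lia.
case=> [t1|]; first by move: (sqf 3%N); rewrite st t1 => /(_ isT).
have [x|x] := leP 0 m; (move=> [|[|]] t1; rewrite t1 in e; exfalso; clear -e x).
- have : m <= 8 \/ 9 <= m by lia. case; nia.
- have : m <= 12 \/ 13 <= m by lia. case; nia.
- have : m <= 15 \/ 16 <= m by lia. case; nia.
- have : m <= -9 \/ -8 <= m by lia. case; nia.
- have : m <= -13 \/ -12 <= m by lia. case; nia.
- have : m <= -16 \/ -15 <= m by lia. case; nia.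
Qed.

(** For n = d g with g = gcd (n, x), the cofactor d is coprime to x / g, hence divides g; then d^2
    divides n. *)
Lemma squarefree_dvd_sqr (n x : nat) :
  squarefree n -> (n %| x * x)%N -> (n %| x)%N.
Proof.
move=> sqf; have [->|n0] := posnP n.
  by rewrite !dvd0n muln_eq0 orbb.
move=> nx.
have g0 : (0 < gcdn n x)%N by rewrite gcdn_gt0 n0.
have [d dn] := dvdnP (dvdn_gcdl n x); have [y yx] := dvdnP (dvdn_gcdr n x).
set g := gcdn n x in g0 dn yx.
have cop : coprime d y.
  by rewrite /coprime -(eqn_pmul2r g0) muln_gcdl -dn -yx mul1n.
have : (d %| g)%N.
  have : (d %| g * (y * y))%N.
    rewrite -(@dvdn_pmul2r g) // -dn; move: nx; rewrite [in (x * x)%N]yx.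
    by rewrite (_ : (g * (y * y) * g = y * g * (y * g))%N) //; nia.
  by rewrite Gauss_dvdl // coprimeMr cop.
move=> dg; have d1 : d = 1%N.
  by apply: sqf; rewrite [n in (_ %| n)%N]dn dvdn_pmul2l //; move: n0; rewrite dn muln_gt0 => /andP[].
by rewrite dn d1 mul1n yx dvdn_mull.
Qed.

(** The square of the denominator of x divides n. The case n = D yields integral coordinates along
    w, the case n = 1 the irrationality of w. *)
Lemma rat_sqr_int (n : nat) (x : rat) (k : int) :
  squarefree n -> n%:R * x ^+ 2 = k%:~R -> exists c : int, x = c%:~R.
Proof.
move=> sqf h; exists (numq x).
suff d1 : denq x = 1 by rewrite -[LHS]divq_num_den d1 divr1.
have dn0 : (denq x)%:~R != 0 :> rat by rewrite intr_eq0 denq_eq0.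
have e : (n%:Z * numq x ^+ 2 = k * denq x ^+ 2).
  apply/eqP; rewrite -(eqr_int rat) !rmorphM /= -h -[n%:Z%:~R]/(n%:R).
  have := divq_num_den x; move: dn0; move: (numq x) (denq x) => N d d0 <-.
  by apply/eqP; field.
have /sqf : (`|denq x| * `|denq x| %| n)%N.
  have cop : coprime (`|denq x| * `|denq x|) (`|numq x| * `|numq x|).
    by rewrite coprimeMl !coprimeMr coprime_sym coprime_num_den.
  rewrite -(Gauss_dvdl _ cop); apply/dvdnP; exists `|k|%N.
  by move: (congr1 absz e); rewrite !abszM /=.
have := denq_gt0 x; lia.
Qed.

(** If b is odd, one of the two squares is 2 mod 4: [n ^+ 2] when e is even, since then e - b^2 is
    odd, and [a ^+ 2] when e is odd. *)
Lemma even_of_sqr_eq (D e a b n v : int) :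
  (D %% 4)%Z = 2 -> (v = 1 \/ v = -1) -> a ^+ 2 = D * e + 4 * v ->
  n ^+ 2 = D * (e - b ^+ 2) ^+ 2 - 16 * v * b ^+ 2 -> exists c, b = 2 * c.
Proof.
move=> D2 hv ha hn.
have hD := divz_eq D 4; rewrite D2 in hD; move: (D %/ 4)%Z hD => d hD.
have [c [hb|hb]] : exists c, b = 2 * c \/ b = 2 * c + 1.
  by exists (b %/ 2)%Z; lia.
  by exists c.
exfalso.
have [f hf] : exists f : int, f = e - b ^+ 2 by eexists.
rewrite -hf in hn.
have [g [hg|hg]] : exists c, f = 2 * c \/ f = 2 * c + 1 by exists (f %/ 2)%Z; lia.
  have [x [hx|hx]] : exists c, a = 2 * c \/ a = 2 * c + 1 by exists (a %/ 2)%Z; lia.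
    have : 4 * x ^+ 2 = (4 * d + 2) * (2 * g + (2 * c + 1) ^+ 2) + 4 * v.
      have -> : 4 * x ^+ 2 = a ^+ 2 by rewrite hx; ring.
      rewrite ha hD; congr (_ + _); rewrite mulrC [RHS]mulrC; lia.
    have -> : (4 * d + 2) * (2 * g + (2 * c + 1) ^+ 2) + 4 * v = 4 * ((2 * d + 1) * g + (2 * d + 1) * (2 * c ^+ 2 + 2 * c) + d + v) + 2 by ring.
    lia.
  have : (2 * x + 1) ^+ 2 = (4 * d + 2) * e + 4 * v by rewrite -hx ha hD; ring.
  have -> : (2 * x + 1) ^+ 2 = 2 * (2 * x ^+ 2 + 2 * x) + 1 :> int by ring.
  have -> : (4 * d + 2) * e + 4 * v = 2 * ((2 * d + 1) * e + 2 * v) by ring.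
  lia.
have [x [hx|hx]] : exists c, n = 2 * c \/ n = 2 * c + 1 by exists (n %/ 2)%Z; lia.
  move: hn; rewrite hx hg hD.
  have -> : (2 * x) ^+ 2 = 4 * x ^+ 2 by ring.
  have -> : (d * 4 + 2) * (2 * g + 1) ^+ 2 - 16 * v * b ^+ 2 =
     4 * (d * (2 * g + 1) ^+ 2 + 2 * g ^+ 2 + 2 * g - 4 * v * b ^+ 2) + 2 by ring.
  lia.
move: hn; rewrite hx hD.
have -> : (2 * x + 1) ^+ 2 = 2 * (2 * x ^+ 2 + 2 * x) + 1 :> int by ring.
have -> : (d * 4 + 2) * f ^+ 2 - 16 * v * b ^+ 2 =
     2 * ((2 * d + 1) * f ^+ 2 - 8 * v * b ^+ 2) by ring.
lia.
Qed.

(* Up to sign, the right-hand coordinate of (a + b w) e0^(+-1) for a suitable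
   sign of the exponent. *)
Lemma unit_descent (s a b : int) : 0 < s -> 0 < a -> 0 < b ->
  (a ^+ 2 = (s ^+ 2 + 2) * b ^+ 2 + 1 \/ a ^+ 2 = (s ^+ 2 + 2) * b ^+ 2 - 1) ->
  `|b * (s ^+ 2 + 1) - a * s| < b.
Proof.
move=> s0 a0 b0 h.
(* The quotient a / b approximates w and lies strictly between s and D / s. Hence s^2 b < a s < (s^2
   + 2) b, which is the claim. *)
have h1 : s * b < a.
  rewrite -(@ltr_pXn2r _ 2) ?nnegrE ?mulr_ge0 1?ltW //.
  by rewrite exprMn; nia.
have s2 : 0 < s ^+ 2 by rewrite exprn_gt0.
have b2 : 1 <= b ^+ 2 by rewrite -gtz0_ge1 exprn_gt0.
have h2 : s * a < (s ^+ 2 + 2) * b.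
  have h3 : (s * a) ^+ 2 < ((s ^+ 2 + 2) * b) ^+ 2.
    have -> : ((s ^+ 2 + 2) * b) ^+ 2 =
      s ^+ 2 * ((s ^+ 2 + 2) * b ^+ 2) + 2 * b ^+ 2 * (s ^+ 2 + 2) by ring.
    rewrite exprMn.
    by case: h => ->; move: (s ^+ 2) (b ^+ 2) s2 b2 => S B; nia.
  have p1 : 0 < s * a by rewrite mulr_gt0.
  have p2 : 0 < (s ^+ 2 + 2) * b by rewrite mulr_gt0 ?addr_gt0.
  by move: h3 p1 p2; move: (s * a) (_ * b) => X Y; nia.
have l1 : b * (s ^+ 2 + 1) - a * s < b by nia.
have l2 : - b < b * (s ^+ 2 + 1) - a * s by nia.
lia.
Qed.

(** * Real inequalities *)

Section LogBounds.
Variable R : realType.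
Implicit Types x y c : R.

(** x + 1/x = 2 cosh (ln x) grows with |ln x|. Concretely, (x - c) (x c - 1) >= 0 leaves only x >= c
    or x <= 1/c. *)
Lemma ln_sqr_ge x c : 0 < x -> 1 <= c -> c + c^-1 <= x + x^-1 ->
  ln c ^+ 2 <= ln x ^+ 2.
Proof.
move=> x0 c1 h; have c0 : 0 < c by apply: lt_le_trans c1.
have lc : 0 <= ln c by rewrite ln_ge0.
have h2 : 0 <= (x - c) * (x * c - 1).
  have -> : (x - c) * (x * c - 1) = (x + x^-1 - (c + c^-1)) * (x * c).
    by field; rewrite !gt_eqF.
  by rewrite mulr_ge0 ?subr_ge0 // mulr_ge0 // ltW.
have [cx|xc] := leP c x.
  by rewrite ler_pXn2r ?nnegrE ?ler_ln ?posrE // ln_ge0 // (le_trans c1).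
have h3 : x * c <= 1 by nra.
have : ln (x * c) <= 0 by rewrite ln_le0.
rewrite lnM ?posrE // => h4.
by rewrite -[leRHS]sqrrN ler_pXn2r ?nnegrE //; lra.
Qed.

Lemma ln_sqr_le x c : 0 < x -> x + x^-1 <= c -> ln x ^+ 2 <= ln c ^+ 2.
Proof.
move=> x0 h; have ix0 : 0 < x^-1 by rewrite invr_gt0.
have c0 : 0 < c by apply: lt_le_trans h; rewrite addr_gt0.
have h1 : ln x <= ln c by rewrite ler_ln ?posrE //; lra.
have h2 : - ln x <= ln c by rewrite -lnV ?posrE // ler_ln ?posrE //; lra.
by rewrite -subr_ge0 subr_sqr mulr_ge0 //; lra.
Qed.

(** One of the two reciprocal sums reaches d; since it is not known which, the other logarithm is
    only used as nonnegative. *)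
Lemma ln_pair_ge x y c d : 0 < x -> 0 < y -> 1 <= c ->
  c + c^-1 <= d -> d + d <= (x + x^-1) + (y + y^-1) ->
  ln c ^+ 2 <= ln x ^+ 2 + ln y ^+ 2.
Proof.
move=> x0 y0 c1 cd h; have [dx|xd] := leP d (x + x^-1).
  have := ln_sqr_ge x0 c1 (le_trans cd dx); have := sqr_ge0 (ln y); lra.
have dy : d <= y + y^-1 by lra.
have := ln_sqr_ge y0 c1 (le_trans cd dy); have := sqr_ge0 (ln x); lra.
Qed.

Lemma nearest_int x : exists k : int, (x - k%:~R) ^+ 2 <= 4^-1.
Proof.
exists (Num.floor (x + 2^-1)).
have /andP[h1 h2] := floor_itv (x + 2^-1).
have e : (Num.floor (x + 2^-1) + 1)%:~R = (Num.floor (x + 2^-1))%:~R + 1 :> R.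
  by rewrite intrD.
rewrite e in h2; nra.
Qed.

End LogBounds.

Lemma integral_rat_int (F : numFieldType) (a : rat) :
  integralOver (intr : int -> F) (ratr a) -> exists z : int, a = z%:~R.
Proof.
case=> p mp rp.
have rp' : root (map_poly (intr : int -> rat) p) a.
  rewrite -(fmorph_root (@ratr F)) -map_poly_comp.
  by rewrite (eq_map_poly (g := intr)) // => z /=; rewrite ratr_int.
have /Cint_rat_Aint : (ratr a : algC) \in Crat by exact: Crat_rat.
have : (ratr a : algC) \in Aint.
  apply: (@root_monic_Aint (map_poly intr p)); last 2 first.
  - exact: monic_map.
  - by apply/polyOverP => i; rewrite coef_map /= intr_int.
  have := rp'; rewrite -(fmorph_root (@ratr algC)) -map_poly_comp.
  by rewrite (eq_map_poly (g := intr)) // => z /=; rewrite ratr_int.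
move=> h /(_ h) /intrP [z]; rewrite -(ratr_int _ z) => /fmorph_inj e.
by exists z.
Qed.

Lemma integral_morph (F1 F2 : fieldType) (f : {rmorphism F1 -> F2}) x :
  integralOver (intr : int -> F1) x -> integralOver (intr : int -> F2) (f x).
Proof.
case=> p mp rp; exists p => //.
have : root (map_poly f (map_poly intr p)) (f x) by rewrite fmorph_root.
by rewrite -map_poly_comp (eq_map_poly (g := intr)) // => z /=; rewrite rmorph_int.
Qed.

(** Meant for t = r / g^2 r and a = [delta]. As t and 1/t have the same sign, |t + 1/t| = |t| +
    1/|t| >= 2, and a > 0 rules out 4 a - 2 <= -2. *)
Lemma recip_trace_bound (R : realFieldType) (t a : R) : t != 0 -> 0 < a ->
  t + t^-1 = - (4 * a - 2) -> 1 <= a /\ `|t| + `|t|^-1 <= 4 * a.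
Proof.
move=> t0 a0 h.
have e : `|t + t^-1| = `|t| + `|t|^-1.
  have [tp|tn|tz] := ltrgt0P t; last by rewrite tz eqxx in t0.
    by rewrite ger0_norm // addr_ge0 ?invr_ge0 ?ltW.
  by rewrite ler0_norm ?opprD ?invrN // -oppr_ge0 opprD addr_ge0 ?oppr_ge0 ?invr_le0 ?ltW.
have h2 : 2 <= `|t| + `|t|^-1.
  have n0 : 0 < `|t| by rewrite normr_gt0.
  move: n0; move: (`|t|) => u u0; rewrite -subr_ge0.
  have -> : u + u^-1 - 2 = (u - 1) ^+ 2 / u by field; rewrite gt_eqF.
  by rewrite mulr_ge0 ?sqr_ge0 ?invr_ge0 ?ltW.
rewrite -e h normrN in h2 *.
have a1 : 1 <= a.
  have [//|h3] := lerP 1 a.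
  by move: h2; rewrite ler_normr => /orP[]; lra.
by split=> //; rewrite ger0_norm; lra.
Qed.

(** Here u = s, c = |s|, and a, b are the two conjugates of [delta]. The larger one is at least half
    the sum, so the product formula and 3 u^2 - 4 u + 4 <= 6 (u^2 - 2 u + 2) bound the smaller one
    by 6. Then 4 b <= 24 <= 2 c and 4 a <= (2 c)^4, whence 17 = 4^2 + 1. *)
Lemma ln_delta_bound (R : realType) (c u a b : R) : 12 <= c -> u ^+ 2 = c ^+ 2 ->
  1 <= a -> 1 <= b -> a + b = 2 * ((u ^+ 2 + 2) * (u ^+ 2 - 2 * u + 2)) ->
  a * b = (3 * u ^+ 2 - 4 * u + 4) * (u ^+ 2 + 2) ->
  ln (4 * a) ^+ 2 + ln (4 * b) ^+ 2 <= 17 * ln (2 * c) ^+ 2.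
Proof.
move=> c12 uc; wlog ba : a b / b <= a.
  move=> hw a1 b1 h1 h2; have [ba|ab] := leP b a; first exact: hw.
  by rewrite addrC; apply: hw => //; [exact: ltW | rewrite addrC | rewrite mulrC].
move=> a1 b1 h1 h2.
have c0 : 0 < c by lra.
have uc1 : - c <= u.
  have [//|uc1] := lerP (- c) u.
  have : 0 < (- c - u) * (c - u) by rewrite mulr_gt0 //; lra.
  by move: uc; nra.
have c2 : 144 <= c ^+ 2 by nra.
set V := u ^+ 2 - 2 * u + 2 in h1.
have V1 : 1 <= V by rewrite /V; nra.
have aU : (u ^+ 2 + 2) * V <= a by lra.
have aU2 : a <= 2 * ((u ^+ 2 + 2) * V) by lra.
have VV : V <= c ^+ 2 + 2 * c + 2 by rewrite /V uc; lra.
have a4 : 4 * a <= (2 * c) ^+ 4.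
  have : (c ^+ 2 + 2) * V <= 2 * c ^+ 4.
    apply: (@le_trans _ _ ((c ^+ 2 + 2) * (c ^+ 2 + 2 * c + 2))).
      by rewrite ler_wpM2l //; lra.
    have -> : c ^+ 4 = c ^+ 2 * c ^+ 2 by ring.
    nra.
  rewrite uc in aU2; have -> : (2 * c) ^+ 4 = 16 * c ^+ 4 by ring.
  lra.
have b6 : b <= 6.
  have p : 0 < (u ^+ 2 + 2) * V by rewrite mulr_gt0 //; [have := sqr_ge0 u|]; lra.
  rewrite -(ler_pM2r p); apply: (@le_trans _ _ (b * a)).
    by rewrite ler_wpM2l //; lra.
  rewrite mulrC h2 (_ : 6 * ((u ^+ 2 + 2) * V) = (6 * V) * (u ^+ 2 + 2)); last by ring.
  by rewrite ler_wpM2r //; [have := sqr_ge0 u; lra | rewrite /V; nra].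
have l1 : 0 <= ln (4 * a) by rewrite ln_ge0 //; lra.
have l2 : 0 <= ln (4 * b) by rewrite ln_ge0 //; lra.
have m1 : ln (4 * a) <= 4 * ln (2 * c).
  have -> : 4 * ln (2 * c) = ln ((2 * c) ^+ 4) by rewrite lnXn ?mulr_natl //; lra.
  by rewrite ler_ln ?posrE ?exprn_gt0 //; lra.
have m2 : ln (4 * b) <= ln (2 * c) by rewrite ler_ln ?posrE; lra.
nra.
Qed.

(* The integers 0, ..., c^2 + d^2 - 1 represent the residues modulo c + d i. *)
Lemma gauss_residue (c d : int) : c ^+ 2 + d ^+ 2 = 1 \/ c ^+ 2 + d ^+ 2 = 5 ->
  forall a b : int, exists x y j : int,
    [/\ 0 <= j, j < c ^+ 2 + d ^+ 2, a = j + (c * x - d * y) & b = d * x + c * y].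
Proof.
move=> h a b.
case: h => h.
  exists (c * a + d * b), (c * b - d * a), 0; rewrite h; split=> //.
    have -> : 0 + (c * (c * a + d * b) - d * (c * b - d * a)) = (c ^+ 2 + d ^+ 2) * a by ring.
    by rewrite h mul1r.
  have -> : d * (c * a + d * b) + c * (c * b - d * a) = (c ^+ 2 + d ^+ 2) * b by ring.
  by rewrite h mul1r.
have : (c = 1 \/ c = -1) /\ (d = 2 \/ d = -2) \/ (c = 2 \/ c = -2) /\ (d = 1 \/ d = -1).
  have c2 : -2 <= c <= 2 by apply/andP; split; nia.
  have d2 : -2 <= d <= 2 by apply/andP; split; nia.
  have : c = -2 \/ c = -1 \/ c = 0 \/ c = 1 \/ c = 2 by lia.
  have : d = -2 \/ d = -1 \/ d = 0 \/ d = 1 \/ d = 2 by lia.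
  by case=> [|[|[|[|]]]] e; case=> [|[|[|[|]]]] e'; move: h; rewrite e e' //; lia.
(* Modulo c + d i of norm 5, the unit i is congruent to d / c, and 1 / c = c^3 mod 5. The quotient x
   + y i is (a - j + b i) (c - d i) / 5. *)
pose j := ((a + d * c ^+ 3 * b) %% 5)%Z.
move=> hcd; exists ((c * (a - j) + d * b) %/ 5)%Z, ((c * b - d * (a - j)) %/ 5)%Z, j.
rewrite h /j {j h}; case: hcd => -[]; case=> -> []-> /=; split; lia.
Qed.

Lemma sum_sqr_odd (c d : int) : c ^+ 2 + d ^+ 2 < 9 ->
  (forall k, c + d <> 2 * k) -> c ^+ 2 + d ^+ 2 = 1 \/ c ^+ 2 + d ^+ 2 = 5.
Proof.
move=> n9 odd.
have hc : c = -2 \/ c = -1 \/ c = 0 \/ c = 1 \/ c = 2.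
  have c2 : -2 <= c <= 2 by apply/andP; split; nia.
  lia.
have hd : d = -2 \/ d = -1 \/ d = 0 \/ d = 1 \/ d = 2.
  have d2 : -2 <= d <= 2 by apply/andP; split; nia.
  lia.
have := odd ((c + d) %/ 2)%Z.
case: hc => [|[|[|[|]]]] ->; case: hd => [|[|[|[|]]]] ->; lia.
Qed.

(** * Units of a cyclic quartic field *)

Definition integral_unit (M : fieldType) (x : M) : Prop :=
  [/\ x != 0, integralOver (intr : int -> M) x & integralOver (intr : int -> M) x^-1].

Lemma ltn_absz (x y : int) (k : nat) :
  (absz y < k.+1)%N -> `|x| < `|y| -> (absz x < k)%N.
Proof. lia. Qed.

(** Used with c = |s| and d = |w|. After squaring, 4 c^2 + 2 + 1 / (4 c^2) is compared with 4 c^2 +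
    8. *)
Lemma add_inv_le (R : realFieldType) (c d : R) :
  1 <= c -> 0 <= d -> d ^+ 2 = c ^+ 2 + 2 -> 2 * c + (2 * c)^-1 <= 2 * d.
Proof.
move=> c1 d0 e; have c0 : 0 < c by lra.
have i1 : c^-1 <= 1 by rewrite invf_le1.
have i0 : 0 < c^-1 by rewrite invr_gt0.
have i2 : 0 < (2 * c)^-1 by rewrite invr_gt0; lra.
suff : (2 * c + (2 * c)^-1) ^+ 2 <= (2 * d) ^+ 2.
  by rewrite ler_pXn2r // nnegrE; lra.
rewrite [leRHS]exprMn e.
have -> : (2 * c + (2 * c)^-1) ^+ 2 = 4 * c ^+ 2 + 2 + c^-1 ^+ 2 / 4.
  by field; rewrite gt_eqF.
nra.
Qed.

Section Units.
Variable M : fieldType.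
Implicit Types x y : M.

Lemma integral_unitM x y : integral_unit x -> integral_unit y -> integral_unit (x * y).
Proof.
case=> x0 ix ix' [y0 iy iy']; split; first by rewrite mulf_neq0.
  exact: integral_mul.
by rewrite invfM; exact: integral_mul.
Qed.

Lemma integral_unitV x : integral_unit x -> integral_unit x^-1.
Proof. by case=> x0 ix ix'; split; rewrite ?invr_eq0 ?invrK. Qed.

Lemma integral_unit1 : integral_unit (1 : M).
Proof. by split; rewrite ?oner_neq0 ?invr1 //; exact: integral1. Qed.

Lemma integral_unitX x (n : int) : integral_unit x -> integral_unit (x ^ n).
Proof.
move=> ux; have nat_case k : integral_unit (x ^+ k).
  elim: k => [|k ih]; first exact: integral_unit1.
  by rewrite exprS; exact: integral_unitM.
by case: n => k; [exact: nat_case | apply: integral_unitV; exact: nat_case].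
Qed.

Lemma integral_unit_morph (N : fieldType) (f : {rmorphism M -> N}) x :
  integral_unit x -> integral_unit (f x).
Proof.
case=> x0 ix ix'; split; rewrite ?fmorph_eq0 -?fmorphV //; exact: integral_morph.
Qed.

Lemma integral_unit_mulV x y :
  integralOver (intr : int -> M) x -> integralOver (intr : int -> M) y ->
  x * y = 1 -> integral_unit x.
Proof.
move=> ix iy xy; have x0 : x != 0.
  by apply/eqP => x0; move: xy (oner_neq0 M); rewrite x0 mul0r => <-; rewrite eqxx.
have xV : x^-1 = y by apply: (mulfI x0); rewrite xy mulfV.
by split; rewrite ?xV.
Qed.

Lemma integral_int (n : int) : integralOver (intr : int -> M) n%:~R.
Proof. exact: integral_id. Qed.
End Units.

(** * Integers and units of the quadratic subfield *)

Section Core.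
Variables (M : fieldType) (R : realType).
Variables (sg : {rmorphism M -> M}) (phi : {rmorphism M -> R}).
Variables (s m : int) (w r : M).
Hypothesis sg4 : forall x, sg (sg (sg (sg x))) = x.
Hypothesis fixQ : forall x, sg x = x -> exists a : rat, x = ratr a.
Hypothesis w2 : w ^+ 2 = s%:~R ^+ 2 + 2.
Hypothesis sgw : sg w = - w.
Hypothesis s0 : s != 0.
Hypothesis hm : 3 * s ^+ 2 - 4 * s + 4 = m ^+ 2.
Hypothesis sqf : squarefree (absz (s ^+ 2 + 2)).

Local Notation D := (s ^+ 2 + 2).
Local Notation S := (s%:~R : M).
Local Notation int_ := (integralOver (intr : int -> M)).
Definition eps0 : M := S ^+ 2 + 1 + S * w.
Local Notation e0 := eps0.

Lemma DE : (D%:~R : M) = S ^+ 2 + 2.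
Proof. by rewrite intrD rmorphXn. Qed.

Lemma intrM_inj : injective (intr : int -> M).
Proof. by move=> a b /(congr1 phi); rewrite !rmorph_int => /intr_inj. Qed.

Lemma phi_inj : injective phi. Proof. exact: fmorph_inj. Qed.

Lemma two_neq0 : (2 : M) != 0.
Proof. by rewrite -(fmorph_eq0 phi) rmorph_nat pnatr_eq0. Qed.

Lemma w_neq0 : w != 0.
Proof.
rewrite -(fmorph_eq0 phi); apply/eqP => h.
have := congr1 phi w2; rewrite rmorphXn h rmorphD rmorphXn rmorph_int rmorph_nat.
by rewrite expr0n /=; have := sqr_ge0 (s%:~R : R); lra.
Qed.

Lemma sg_e0 : sg e0 = S ^+ 2 + 1 - S * w.
Proof. by rewrite /e0 !rmorphD rmorphXn rmorphM rmorph_int rmorph1 sgw mulrN. Qed.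

Lemma e0_sg : e0 * sg e0 = 1.
Proof.
rewrite sg_e0 /e0.
have -> : (S ^+ 2 + 1 + S * w) * (S ^+ 2 + 1 - S * w) =
  (S ^+ 2 + 1) ^+ 2 - S ^+ 2 * w ^+ 2 by ring.
by rewrite w2; ring.
Qed.

Lemma e0_neq0 : e0 != 0.
Proof.
by apply/eqP => h; move: e0_sg (oner_neq0 M); rewrite h mul0r => <-; rewrite eqxx.
Qed.

Lemma e0V : e0^-1 = sg e0.
Proof. by rewrite -[LHS]mulr1 -e0_sg mulKf ?e0_neq0. Qed.

Lemma sgeV : sg e0 = e0^-1. Proof. by rewrite e0V. Qed.

Lemma int_ratr (a : rat) : int_ (ratr a) -> exists z : int, a = z%:~R.
Proof.
move=> h; apply: (@integral_rat_int R).
by rewrite -(fmorph_rat phi); exact: integral_morph.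
Qed.

Lemma int_fix x : int_ x -> sg x = x -> exists z : int, x = z%:~R.
Proof.
move=> ix /fixQ[a xa]; rewrite xa in ix *; have [z ->] := int_ratr ix.
by exists z; apply: phi_inj; rewrite fmorph_rat ratr_int rmorph_int.
Qed.

Lemma quad_inj (a b c d : int) :
  a%:~R + b%:~R * w = c%:~R + d%:~R * w -> a = c /\ b = d.
Proof.
move=> h; have := congr1 sg h.
rewrite !rmorphD !rmorphM !rmorph_int sgw => h'.
have e1 : (2 : M) * (a%:~R - c%:~R) = 0.
  have := congr1 (fun x => x + (a%:~R + b%:~R * - w)) h.
  rewrite {2}h' => e; have : (a%:~R + b%:~R * w + (a%:~R + b%:~R * - w)) - (c%:~R + d%:~R * w + (c%:~R + d%:~R * - w)) = 0.
    by rewrite e subrr.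
  by move=> <-; ring.
have ac : a = c.
  apply: intrM_inj; apply/eqP; rewrite -subr_eq0.
  by move/eqP: e1; rewrite mulf_eq0 (negPf two_neq0).
split=> //; apply: intrM_inj; apply: (mulIf w_neq0); apply: (addrI a%:~R).
by rewrite h ac.
Qed.

(** The ring of integers of k is Z[w]. Trace and norm give 2 x = t + b w with D b^2 = t^2 - 4 u;
    squarefreeness makes b an integer, and D = 2 mod 4 makes t and b even. *)
Lemma int_quadfix x : int_ x -> sg (sg x) = x ->
  exists a b : int, x = a%:~R + b%:~R * w.
Proof.
move=> ix xx; have isx : int_ (sg x) by exact: integral_morph.
have [t te] : exists t : int, x + sg x = t%:~R.
  apply: int_fix; first exact: integral_add.
  by rewrite rmorphD xx addrC.
have [u ue] : exists u : int, x * sg x = u%:~R.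
  apply: int_fix; first exact: integral_mul.
  by rewrite rmorphM xx mulrC.
have [c ce] : exists c : rat, (x - sg x) * w = ratr c.
  by apply: fixQ; rewrite rmorphM rmorphB xx sgw; ring.
have dn : D%:~R != 0 :> rat.
  by rewrite intr_eq0; have := sqr_ge0 s; lia.
have xmx : (x - sg x) ^+ 2 = (t ^+ 2 - 4 * u)%:~R.
  rewrite rmorphB rmorphXn rmorphM /= -te -ue; ring.
(* c / D is the coordinate b in x - [sg x] = b w, since (x - [sg x]) w = c and w^2 = D. *)
have [b be] : exists b : int, c / D%:~R = b%:~R.
  apply: (@rat_sqr_int _ _ (t ^+ 2 - 4 * u) sqf).
  have -> : (absz D)%:R = D%:~R :> rat.
    by rewrite -[LHS]/((absz D)%:Z%:~R) gez0_abs // addr_ge0 ?sqr_ge0.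
  have ce2 : c ^+ 2 = D%:~R * (t ^+ 2 - 4 * u)%:~R.
    apply: (fmorph_inj (@ratr R)); rewrite rmorphXn /= rmorphM /= !ratr_int -(fmorph_rat phi) -ce.
    rewrite -rmorphXn /= exprMn w2 xmx -DE rmorphM !rmorph_int.
    by rewrite mulrC.
  have cancel2 (d k : rat) : d != 0 -> d * (d * k / d ^+ 2) = k by move=> d0; field.
  by rewrite expr_div_n ce2 cancel2.
have xd : x - sg x = b%:~R * w.
  apply: (mulIf w_neq0); rewrite ce -mulrA -expr2 w2 -DE.
  apply: phi_inj; rewrite fmorph_rat rmorphM !rmorph_int.
  have -> : c = b%:~R * D%:~R by rewrite -be divfK.
  by rewrite rmorphM /= !ratr_int.
have xt : 2 * x = t%:~R + b%:~R * w by rewrite -te -xd; ring.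
have e : t ^+ 2 - 4 * u = D * b ^+ 2.
  by apply: intrM_inj; rewrite -xmx xd exprMn w2 -DE [RHS]intrM -rmorphXn mulrC.
have [s' se] := family_even hm.
have [t' tt] : exists c, t = 2 * c.
  have [t' [|tt]] : exists c, t = 2 * c \/ t = 2 * c + 1 by exists (t %/ 2)%Z; lia.
    by move=> ->; exists t'.
  exfalso; move: e; rewrite tt se.
  have -> : ((2 * s') ^+ 2 + 2) * b ^+ 2 = 2 * ((2 * s' ^+ 2 + 1) * b ^+ 2) by ring.
  have -> : (2 * t' + 1) ^+ 2 - 4 * u = 2 * (2 * t' ^+ 2 + 2 * t' - 2 * u) + 1 by ring.
  lia.
have [b' bb] : exists c, b = 2 * c.
  have [b' [|bb]] : exists c, b = 2 * c \/ b = 2 * c + 1 by exists (b %/ 2)%Z; lia.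
    by move=> ->; exists b'.
  exfalso; move: e; rewrite tt se bb.
  have -> : ((2 * s') ^+ 2 + 2) * (2 * b' + 1) ^+ 2 =
    4 * (s' ^+ 2 * (2 * b' + 1) ^+ 2 + 2 * b' ^+ 2 + 2 * b') + 2 by ring.
  have -> : (2 * t') ^+ 2 - 4 * u = 4 * (t' ^+ 2 - u) by ring.
  lia.
exists t', b'; apply: (mulfI two_neq0); rewrite xt tt bb !rmorphM /=.
by ring.
Qed.

Lemma sg_quad (a b : int) : sg (a%:~R + b%:~R * w) = a%:~R - b%:~R * w.
Proof. by rewrite rmorphD rmorphM !rmorph_int sgw mulrN. Qed.

Lemma quad_norm (a b : int) :
  (a%:~R + b%:~R * w) * sg (a%:~R + b%:~R * w) = (a ^+ 2 - D * b ^+ 2)%:~R.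
Proof.
rewrite sg_quad [RHS]intrB [(D * _)%:~R]intrM DE -w2 !rmorphXn /=; ring.
Qed.

Lemma unit_fix x : integral_unit x -> sg x = x -> x = 1 \/ x = -1.
Proof.
case=> x0 ix ix' xf.
have [a ae] := int_fix ix xf.
have [b be] : exists b : int, x^-1 = b%:~R by apply: int_fix; rewrite ?fmorphV ?xf.
have ab : a * b = 1.
  by apply: intrM_inj; rewrite rmorphM /= -ae -be mulfV.
have : a = 1 \/ a = -1.
  by have /eqP := congr1 absz ab; rewrite abszM muln_eq1 => /andP[/eqP]; lia.
by rewrite ae; case=> ->; [left|right].
Qed.

Lemma exprzN1 (x : M) : x ^ (-1) = x^-1. Proof. by []. Qed.

(** Descent on |b|: dividing by [e0] or by its inverse keeps the norm and, by [unit_descent], makes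
    |b| strictly smaller until b = 0. *)
Lemma quad_unit (a b : int) : a ^+ 2 - D * b ^+ 2 = 1 \/ a ^+ 2 - D * b ^+ 2 = -1 ->
  exists n : int, a%:~R + b%:~R * w = e0 ^ n \/ a%:~R + b%:~R * w = - e0 ^ n.
Proof.
have [k] := ubnP (absz b); elim: k a b => // k ih a b bk h.
have [b0|b0] := eqVneq b 0.
  exists 0; rewrite b0 mul0r addr0 expr0z.
  have : a = 1 \/ a = -1 by move: h; rewrite b0 expr0n /= mulr0 subr0; nia.
  by case=> ->; [left|right].
have a0 : a != 0.
  by apply/eqP => a0; move: h; rewrite a0 expr0n /= sub0r; have := sqr_ge0 s; nia.
have sgn (x : int) : x != 0 -> exists u y : int, [/\ x = u * y, 0 < y, u = 1 \/ u = -1 & `|x| = y].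
  by move=> x0; have [x1|x1] := ltP 0 x; [exists 1, x | exists (-1), (- x)]; split; lia.
have [ua [a1 [ae a1p uae _]]] := sgn _ a0.
have [ub [b1 [be b1p ube b1e]]] := sgn _ b0.
have [us [s1 [se s1p use _]]] := sgn _ s0.
have sq1 (u : int) : u = 1 \/ u = -1 -> u ^+ 2 = 1 by case=> ->.
(* The exponent t is the sign of a b s, chosen so that the two terms of b' below cancel rather than
   add up. *)
have [t te] : exists t : int, t = ua * ub * us by eexists.
have t1 : t = 1 \/ t = -1.
  by rewrite te; case: uae => ->; case: ube => ->; case: use => ->; [left|right|right|left|right|left|left|right].
have t2 := sq1 _ t1.
pose a' : int := a * (s ^+ 2 + 1) - t * b * s * D.
pose b' : int := b * (s ^+ 2 + 1) - t * a * s.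
have ss : s ^+ 2 = s1 ^+ 2 by rewrite se exprMn (sq1 us) // mul1r.
have tas : t * a * s = ub * (a1 * s1).
  rewrite te ae [in LHS]se.
  have -> : ua * ub * us * (ua * a1) * (us * s1) = ua ^+ 2 * us ^+ 2 * (ub * (a1 * s1)) by ring.
  by rewrite !sq1 // !mul1r.
have be' : b' = ub * (b1 * (s1 ^+ 2 + 1) - a1 * s1).
  by rewrite /b' tas -ss be; ring.
have b'lt : `|b'| < `|b|.
  rewrite b1e be' normrM.
  have -> : `|ub| = 1 by case: ube => ->.
  rewrite mul1r; apply: unit_descent => //.
  move: h; rewrite ae be ss !exprMn (sq1 ua) // (sq1 ub) // !mul1r => h.
  by case: h => h; [left | right]; rewrite -[LHS](subrK ((s1 ^+ 2 + 2) * b1 ^+ 2)) h addrC.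
have hn : a' ^+ 2 - D * b' ^+ 2 = a ^+ 2 - D * b ^+ 2.
  have -> : a' ^+ 2 - D * b' ^+ 2 = (a ^+ 2 - D * b ^+ 2) * ((s ^+ 2 + 1) ^+ 2 - t ^+ 2 * (s ^+ 2 * D)).
    by rewrite /a' /b'; ring.
  by rewrite t2; ring.
have bk' : (`|b'| < k)%N by exact: ltn_absz bk b'lt.
have step : a%:~R + b%:~R * w = (a'%:~R + b'%:~R * w) * e0 ^ t.
  have e0t : e0 ^ t = S ^+ 2 + 1 + t%:~R * S * w.
    case: t1 => ->; first by rewrite expr1z /e0 mul1r.
    by rewrite exprzN1 e0V sg_e0 mulrN1z; ring.
  have T2 : (t%:~R : M) ^+ 2 = 1 by rewrite -rmorphXn t2.
  rewrite e0t /a' /b' !intrB !intrM DE intrD !rmorphXn /=.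
  transitivity ((a%:~R + b%:~R * w) * ((S ^+ 2 + 1) ^+ 2 - t%:~R ^+ 2 * (S ^+ 2 * w ^+ 2)) : M).
    by rewrite T2 w2; ring.
  have ww : w * w = S ^+ 2 + 2 by rewrite -expr2.
  rewrite -w2; ring.
rewrite -hn in h; have [n hx] := ih _ _ bk' h.
exists (n + t); rewrite expfzDr ?e0_neq0 // step.
by case: hx => ->; [left | right; rewrite mulNr].
Qed.

Lemma unit_quadfix x : integral_unit x -> sg (sg x) = x ->
  exists n : int, x = e0 ^ n \/ x = - e0 ^ n.
Proof.
move=> ux xx; have [a [b xe]] : exists a b : int, x = a%:~R + b%:~R * w.
  by case: ux => *; exact: int_quadfix.
have hN : x * sg x = 1 \/ x * sg x = -1.
  apply: unit_fix; last by rewrite rmorphM xx mulrC.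
  by apply: integral_unitM => //; exact: integral_unit_morph.
rewrite xe; apply: quad_unit.
rewrite xe quad_norm in hN.
by case: hN => hN; [left|right]; apply: intrM_inj; rewrite hN.
Qed.

(** * Relative units and the lower bound for [logq] *)

Definition rel_unit (x : M) : Prop :=
  integral_unit x /\ (x * sg (sg x) = 1 \/ x * sg (sg x) = -1).

Definition logq (x : M) : R := ln `|phi x| ^+ 2 + ln `|phi (sg x)| ^+ 2.

Lemma int_fixN x : int_ x -> sg x = - x -> exists2 n : int,
  x = n%:~R * w & x ^+ 2 = (n ^+ 2 * D)%:~R.
Proof.
move=> ix xN; have xx : sg (sg x) = x by rewrite xN rmorphN xN opprK.
have [a [b xe]] := int_quadfix ix xx.
move: xN; rewrite xe sg_quad => xN.
have [a0 _] : a = - a /\ - b = - b.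
  apply: quad_inj; rewrite !intrN mulNr xN; ring.
have -> : a = 0 by lia.
exists b; rewrite add0r // exprMn w2 -DE intrM rmorphXn //.
Qed.

(* The hypothesis says that the norm of the discriminant (a + b w)^2 - 4 v is
   D times a square: this is where the cyclicity of the quartic field enters. *)
Lemma trace_even (a b v n : int) : v = 1 \/ v = -1 ->
  (a ^+ 2 + b ^+ 2 * D - 4 * v) ^+ 2 - 4 * a ^+ 2 * b ^+ 2 * D = n ^+ 2 * D ->
  exists c : int, b = 2 * c.
Proof.
move=> v1 h; have [t st] := family_even hm.
have Dp : 0 < D by have := sqr_ge0 s; lia.
(* The hypothesis shows that D divides the square of a^2 - 4 v; squarefreeness removes the
   square. *)
have : (D %| a ^+ 2 - 4 * v)%Z.
  rewrite /dvdz /=; apply: squarefree_dvd_sqr => //.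
  rewrite -abszM -/(dvdz D _) -expr2; apply/dvdzP.
  exists (n ^+ 2 - 2 * (a ^+ 2 - 4 * v) * b ^+ 2 - b ^+ 4 * D + 4 * a ^+ 2 * b ^+ 2).
  rewrite !mulrDl mulNr -h; ring.
case/dvdzP => e he; apply: (@even_of_sqr_eq D e a b n v) => //.
- rewrite st (_ : (2 * t) ^+ 2 + 2 = t ^+ 2 * 4 + 2); last by ring.
  by rewrite modzMDl.
- by rewrite mulrC -he subrK.
apply: (@mulIf _ D); first by rewrite gt_eqF.
have ha : a ^+ 2 = e * D + 4 * v by rewrite -he subrK.
rewrite -h ha; ring.
Qed.

(** If b = 0, then x and [sg x] have the same relative trace and norm, so [sg x] is x or its
    relative conjugate; either way x is fixed, hence +-1. Parity comes from [trace_even]: the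
    product of the two differences of relative conjugates changes sign under [sg], so it is n w, and
    its square is the norm of the relative discriminant. *)
Lemma rel_unit_trace x : rel_unit x -> x <> 1 -> x <> -1 ->
  exists a b : int, [/\ x + sg (sg x) = a%:~R + b%:~R * w & (2 <= `|b|)%R].
Proof.
case=> ux hv x1 xN1.
have [v [v1 vE]] : exists v : int, (v = 1 \/ v = -1) /\ x * sg (sg x) = v%:~R.
  by case: hv => ->; [exists 1 | exists (-1)]; split => //; [left|right].
have ix : int_ x by case: ux.
have ix1 : int_ (sg x) by exact: integral_morph.
have ix2 : int_ (sg (sg x)) by exact: integral_morph.
have ix3 : int_ (sg (sg (sg x))) by exact: integral_morph.
have [a [b Ae]] : exists a b : int, x + sg (sg x) = a%:~R + b%:~R * w.
  apply: int_quadfix; first exact: integral_add.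
  by rewrite !rmorphD sg4 addrC.
exists a, b; split=> //.
have vE1 : sg x * sg (sg (sg x)) = v%:~R by rewrite -rmorphM vE rmorph_int.
have Be : sg x + sg (sg (sg x)) = a%:~R - b%:~R * w by rewrite -rmorphD Ae sg_quad.
have b0 : b != 0.
  apply/eqP => b0; move: Ae Be; rewrite b0 !mul0r addr0 subr0 => Ae Be.
  have : (sg x - x) * (sg x - sg (sg x)) = 0.
    have -> : (sg x - x) * (sg x - sg (sg x)) =
      sg x ^+ 2 - (x + sg (sg x)) * sg x + x * sg (sg x) by ring.
    by rewrite Ae -Be vE -vE1; ring.
  have fixx : sg x = x -> False by move=> xf; case: (unit_fix ux xf).
  move/eqP; rewrite mulf_eq0 !subr_eq0 => /orP[/eqP //|/eqP /(fmorph_inj sg) /esym //].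
have [n _ ne] : exists2 n : int,
    (x - sg (sg x)) * (sg x - sg (sg (sg x))) = n%:~R * w &
    ((x - sg (sg x)) * (sg x - sg (sg (sg x)))) ^+ 2 = (n ^+ 2 * D)%:~R.
  apply: int_fixN; first by apply: integral_mul; exact: integral_sub.
  by rewrite rmorphM !rmorphB sg4; ring.
suff [c bc] : exists c : int, b = 2 * c by lia.
apply: (@trace_even a b v n v1); apply: intrM_inj; rewrite -ne.
have -> : ((x - sg (sg x)) * (sg x - sg (sg (sg x)))) ^+ 2 =
   ((x + sg (sg x)) ^+ 2 - 4 * (x * sg (sg x))) *
   ((sg x + sg (sg (sg x))) ^+ 2 - 4 * (sg x * sg (sg (sg x)))) by ring.
rewrite Ae Be vE vE1.
have -> : ((a ^+ 2 + b ^+ 2 * D - 4 * v) ^+ 2 - 4 * a ^+ 2 * b ^+ 2 * D)%:~R =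
  (a%:~R ^+ 2 + b%:~R ^+ 2 * w ^+ 2 - 4 * v%:~R) ^+ 2 - 4 * a%:~R ^+ 2 * b%:~R ^+ 2 * w ^+ 2 :> M.
  by rewrite w2; ring.
ring.
Qed.

Lemma s_ge12 : 12 <= `|s|. Proof. exact: (family_ge12 hm). Qed.

(** The relative traces of x and [sg x] differ by 2 b w, of size at least 4 |w|. Hence |x| + 1/|x|
    or the same sum for [sg x] is at least 2 |w|, which exceeds the value of that sum at 2 |s|. *)
Lemma rel_unit_logq x : rel_unit x -> x <> 1 -> x <> -1 ->
  ln (2 * `|s|%:~R) ^+ 2 <= logq x.
Proof.
move=> rx x1 xN1; have [a [b [Ae b2]]] := rel_unit_trace rx x1 xN1.
case: rx => -[x0 _ _] hv.
have Be : sg x + sg (sg (sg x)) = a%:~R - b%:~R * w by rewrite -rmorphD Ae sg_quad.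
have px : 0 < `|phi x| by rewrite normr_gt0 fmorph_eq0.
have psx : 0 < `|phi (sg x)| by rewrite normr_gt0 !fmorph_eq0.
have nV y : y != 0 -> y * sg (sg y) = 1 \/ y * sg (sg y) = -1 -> `|phi (sg (sg y))| = `|phi y|^-1.
  move=> y0 hy; have py : `|phi y| != 0 by rewrite normr_eq0 fmorph_eq0.
  apply: (mulfI py); rewrite mulfV // -normrM -rmorphM.
  by case: hy => ->; rewrite ?rmorphN rmorph1 ?normrN normr1.
have nx := nV _ x0 hv.
have nsx : `|phi (sg (sg (sg x)))| = `|phi (sg x)|^-1.
  apply: nV; first by rewrite fmorph_eq0.
  by rewrite -rmorphM; case: hv => ->; [left|right]; rewrite ?rmorphN rmorph1.
have s1 : 12 <= `|s|%:~R :> R by have := s_ge12; rewrite -(ler_int R).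
have w2R : phi w ^+ 2 = `|s|%:~R ^+ 2 + 2.
  by rewrite -rmorphXn w2 rmorphD rmorphXn rmorph_int rmorph_nat intr_norm real_normK ?num_real.
apply: (ln_pair_ge (d := 2 * `|phi w|)) => //.
- lra.
- by apply: add_inv_le; rewrite ?normr_ge0 ?real_normK ?num_real // (le_trans _ s1) // ler1n.
have e : phi (x + sg (sg x)) - phi (sg x + sg (sg (sg x))) = 2 * b%:~R * phi w.
  by rewrite Ae Be !(rmorphD, rmorphB, rmorphM) !rmorph_int; ring.
rewrite -nx -nsx.
have h1 : `|2 * b%:~R * phi w| = 2 * `|b|%:~R * `|phi w|.
  by rewrite !normrM intr_norm normr_nat.
have h2 := ler_normB (phi (x + sg (sg x))) (phi (sg x + sg (sg (sg x)))).
have h3 := ler_normD (phi x) (phi (sg (sg x))).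
have h4 := ler_normD (phi (sg x)) (phi (sg (sg (sg x)))).
rewrite -(rmorphD phi) in h3; rewrite -(rmorphD phi) in h4; rewrite e h1 in h2.
have h5 : 2 * `|phi w| <= `|b|%:~R * `|phi w|.
  by rewrite ler_wpM2r //; move: b2; rewrite -(ler_int R).
by clear x1 xN1; lra.
Qed.

(** * Logarithms and the Z[i]-module of relative units *)

Implicit Types x y : M.

Definition lg (x : M) : R := ln `|phi x|.

Lemma nphi_gt0 x : x != 0 -> 0 < `|phi x|.
Proof. by move=> x0; rewrite normr_gt0 fmorph_eq0. Qed.

Lemma lgM x y : x != 0 -> y != 0 -> lg (x * y) = lg x + lg y.
Proof. by move=> x0 y0; rewrite /lg rmorphM normrM lnM ?posrE ?nphi_gt0. Qed.

Lemma lgV x : x != 0 -> lg x^-1 = - lg x.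
Proof. by move=> x0; rewrite /lg fmorphV normfV lnV ?posrE ?nphi_gt0. Qed.

Lemma lg1 : lg 1 = 0. Proof. by rewrite /lg rmorph1 normr1 ln1. Qed.

Lemma lgN x : lg (- x) = lg x. Proof. by rewrite /lg rmorphN normrN. Qed.

Lemma lg_sqr x y : x ^+ 2 = y ^+ 2 -> lg x = lg y.
Proof. by move/eqP; rewrite eqf_sqr => /orP[/eqP->|/eqP->] //; rewrite lgN. Qed.

Lemma lgX x (n : int) : x != 0 -> lg (x ^ n) = n%:~R * lg x.
Proof.
move=> x0; have pos k : lg (x ^+ k) = k%:R * lg x.
  elim: k => [|k ih]; first by rewrite expr0 lg1 mul0r.
  by rewrite exprS lgM ?expf_neq0 // ih mulrS mulrDl mul1r.
case: n => k; first exact: pos.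
by rewrite -[x ^ Negz k]/((x ^+ k.+1)^-1) lgV ?expf_neq0 // pos NegzE intrN mulNr.
Qed.

Lemma lg_eq0 x : x != 0 -> lg x = 0 -> x ^+ 2 = 1.
Proof.
move=> x0 /eqP; rewrite /lg ln_eq0 ?nphi_gt0 // => /eqP h.
by apply: phi_inj; rewrite rmorphXn rmorph1 -real_normK ?num_real // h expr1n.
Qed.

Lemma sqr_eq1 x : x ^+ 2 = 1 -> x = 1 \/ x = -1.
Proof. by move/eqP; rewrite sqrf_eq1 => /orP[]/eqP->; [left|right]. Qed.

Lemma sg_neq0 x : x != 0 -> sg x != 0. Proof. by rewrite fmorph_eq0. Qed.

Lemma rel_unit_neq0 x : rel_unit x -> x != 0. Proof. by case=> -[]. Qed.

(** Squaring turns the choice of sign into one equation, visibly stable under products, powers and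
    conjugation. *)
Lemma rel_unit_sqr x : rel_unit x <-> integral_unit x /\ (sg (sg x)) ^+ 2 = (x ^+ 2)^-1.
Proof.
split=> -[ux h]; split=> //; have x0 : x != 0 by case: ux.
  apply: (mulfI (expf_neq0 2 x0)); rewrite mulfV ?expf_neq0 // -exprMn.
  by case: h => ->; rewrite ?sqrrN expr1n.
by apply: sqr_eq1; rewrite exprMn h mulfV ?expf_neq0.
Qed.

Lemma lg_sgsg x : rel_unit x -> lg (sg (sg x)) = - lg x.
Proof.
move=> rx; have x0 := rel_unit_neq0 rx; rewrite -lgV //; apply: lg_sqr.
by rewrite exprVn; case/rel_unit_sqr: rx.
Qed.

Lemma rel_unitM x y : rel_unit x -> rel_unit y -> rel_unit (x * y).
Proof.
move=> /rel_unit_sqr[ux hx] /rel_unit_sqr[uy hy]; apply/rel_unit_sqr; split.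
  exact: integral_unitM.
by rewrite !rmorphM !exprMn hx hy [RHS]invfM.
Qed.

Lemma exprz_sqr x (n : int) : (x ^ n) ^+ 2 = (x ^+ 2) ^ n.
Proof. exact: (exprzAC x n 2). Qed.

Lemma rel_unitX x (n : int) : rel_unit x -> rel_unit (x ^ n).
Proof.
move=> /rel_unit_sqr[ux hx]; apply/rel_unit_sqr; split; first exact: integral_unitX.
by rewrite !fmorphXz !exprz_sqr hx exprz_inv invr_expz.
Qed.

Lemma rel_unit_sg x : rel_unit x -> rel_unit (sg x).
Proof.
move=> /rel_unit_sqr[ux hx]; apply/rel_unit_sqr; split; first exact: integral_unit_morph.
by rewrite -rmorphXn hx fmorphV rmorphXn.
Qed.

(* The power x^(a + b i) in the Z[i]-module of relative units. *)
Definition gpow (x : M) (a b : int) : M := x ^ a * sg x ^ b.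

Lemma gpow_neq0 x a b : x != 0 -> gpow x a b != 0.
Proof. by move=> x0; rewrite mulf_neq0 ?expfz_neq0 ?sg_neq0. Qed.

Lemma rel_unit_gpow x a b : rel_unit x -> rel_unit (gpow x a b).
Proof. by move=> rx; apply: rel_unitM; apply: rel_unitX => //; exact: rel_unit_sg. Qed.

Lemma gpowD x a b c d : x != 0 -> gpow x (a + c) (b + d) = gpow x a b * gpow x c d.
Proof. by move=> x0; rewrite /gpow !expfzDr ?sg_neq0 // mulrACA. Qed.

Lemma gpow00 x : gpow x 0 0 = 1. Proof. by rewrite /gpow !expr0z mul1r. Qed.

Lemma gpowN x a b : x != 0 -> gpow x (- a) (- b) = (gpow x a b)^-1.
Proof.
move=> x0; apply: (mulfI (gpow_neq0 a b x0)).
by rewrite -gpowD // !subrr gpow00 mulfV ?gpow_neq0.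
Qed.

Lemma lg_gpow x a b : x != 0 -> lg (gpow x a b) = a%:~R * lg x + b%:~R * lg (sg x).
Proof. by move=> x0; rewrite lgM ?expfz_neq0 ?sg_neq0 // !lgX ?sg_neq0. Qed.

Lemma sg_gpow x a b : sg (gpow x a b) = gpow (sg x) a b.
Proof. by rewrite /gpow rmorphM !fmorphXz. Qed.

(** For Z(x) = lg x - i lg (sg x) this reads |Z(y) + (a + b i) Z(x)|^2; it rests on lg (sg (sg x)) =
    - lg x. *)
Lemma logq_gpow x y a b : y != 0 -> rel_unit x ->
  logq (y * gpow x a b) =
    (lg y + a%:~R * lg x + b%:~R * lg (sg x)) ^+ 2 +
    (lg (sg y) + a%:~R * lg (sg x) - b%:~R * lg x) ^+ 2.
Proof.
move=> y0 rx; have x0 := rel_unit_neq0 rx.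
rewrite /logq -!/(lg _) rmorphM sg_gpow.
rewrite (lgM y0 (gpow_neq0 a b x0)) (lgM (sg_neq0 y0) (gpow_neq0 a b (sg_neq0 x0))).
by rewrite !lg_gpow ?sg_neq0 // lg_sgsg // mulrN !addrA.
Qed.

Definition nontrivial (x : M) : Prop := rel_unit x /\ x ^+ 2 <> 1.

Local Notation z := (ln (2 * `|s|%:~R) : R).

Lemma z_gt0 : 0 < z.
Proof.
have s1 : 12 <= `|s|%:~R :> R by have := s_ge12; rewrite -(ler_int R).
by rewrite ln_gt0 //; lra.
Qed.

Lemma nontrivial_logq x : nontrivial x -> z ^+ 2 <= logq x.
Proof.
by case=> rx x1; apply: rel_unit_logq => // h; apply: x1; rewrite h ?sqrrN expr1n.
Qed.

(** A minimum up to the factor 2 is enough for Euclidean division and needs no infimum: replacing x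
    by a t with at most half its [logq] stops, because [logq] stays above z^2. *)
Lemma minimal_rel_unit x : nontrivial x -> exists2 y, nontrivial y &
  forall t, nontrivial t -> logq y < 2 * logq t.
Proof.
have step n : forall x, nontrivial x -> logq x < 2 ^+ n * z ^+ 2 ->
    exists2 y, nontrivial y & forall t, nontrivial t -> logq y < 2 * logq t.
  elim: n => [|n ih] {}x nx hx.
    by have := nontrivial_logq nx; rewrite leNgt -[z ^+ 2]mul1r hx.
  have [good|bad] := boolp.pselect (forall t, nontrivial t -> logq x < 2 * logq t).
    by exists x.
  have [t nt ht] : exists2 t, nontrivial t & 2 * logq t <= logq x.
    apply: boolp.contrapT => h; apply: bad => t nt; rewrite ltNge; apply/negP => ht.
    by apply: h; exists t.
  by apply: (ih t nt); move: hx; rewrite exprS -mulrA; lra.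
move=> nx; have [n hn] : exists n : nat, logq x < 2 ^+ n * z ^+ 2.
  have z2 : 0 < z ^+ 2 by rewrite exprn_gt0 ?z_gt0.
  exists (Num.truncn (logq x / z ^+ 2)).+1; rewrite -ltr_pdivrMr //.
  apply: lt_le_trans (truncnS_gt _) _; rewrite -natrX ler_nat.
  exact: ltnW (ltn_expl _ _).
exact: step nx hn.
Qed.

Lemma minimal_generates y t : nontrivial y ->
  (forall t, nontrivial t -> logq y < 2 * logq t) -> rel_unit t ->
  exists a b : int, t ^+ 2 = gpow y a b ^+ 2.
Proof.
move=> ny hy rt; have [ry _] := ny; have y0 := rel_unit_neq0 ry.
have Q0 : 0 < logq y.
  by apply: lt_le_trans (nontrivial_logq ny); rewrite exprn_gt0 ?z_gt0.
have QE : logq y = lg y ^+ 2 + lg (sg y) ^+ 2 by [].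
(* t1 + t2 i is the complex quotient Z(t) / Z(y) for Z = lg - i (lg o sg). Rounding both coordinates
   leaves an error of squared modulus at most 1/2. *)
pose t1 := (lg y * lg t + lg (sg y) * lg (sg t)) / logq y.
pose t2 := (lg (sg y) * lg t - lg y * lg (sg t)) / logq y.
have [a ha] := nearest_int t1; have [b hb] := nearest_int t2.
exists a, b; have t0 := rel_unit_neq0 rt.
have rt' : rel_unit (t * gpow y (- a) (- b)) by apply: rel_unitM => //; exact: rel_unit_gpow.
have e : logq (t * gpow y (- a) (- b)) =
    logq y * ((t1 - a%:~R) ^+ 2 + (t2 - b%:~R) ^+ 2).
  rewrite logq_gpow // /t1 /t2; move: Q0; rewrite QE => Q0; rewrite !intrN.
  by field; rewrite gt_eqF.
have h : 2 * logq (t * gpow y (- a) (- b)) <= logq y by rewrite e; nra.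
have : (t * gpow y (- a) (- b)) ^+ 2 = 1.
  apply: boolp.contrapT => h1; have := hy _ (conj rt' h1); lra.
rewrite exprMn gpowN // exprVn => h1.
by apply: (mulIf (invr_neq0 (expf_neq0 2 (gpow_neq0 a b y0)))); rewrite h1 mulfV ?expf_neq0 ?gpow_neq0.
Qed.

(** [logq] is multiplied by the Gaussian norm a^2 + b^2 and vanishes on +-1. *)
Lemma gpow_inj y a b : nontrivial y -> gpow y a b ^+ 2 = 1 -> a = 0 /\ b = 0.
Proof.
move=> ny h; have [ry _] := ny; have y0 := rel_unit_neq0 ry.
have Q0 : 0 < logq y.
  by apply: lt_le_trans (nontrivial_logq ny); rewrite exprn_gt0 ?z_gt0.
have : logq (1 * gpow y a b) = (a%:~R ^+ 2 + b%:~R ^+ 2) * logq y.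
  rewrite logq_gpow ?oner_neq0 // rmorph1 lg1 /logq -!/(lg _); ring.
have -> : logq (1 * gpow y a b) = 0.
  have [l1 l2] : lg (gpow y a b) = 0 /\ lg (sg (gpow y a b)) = 0.
    split; rewrite -lg1; apply: lg_sqr; rewrite expr1n //.
    by rewrite -rmorphXn h rmorph1.
  by rewrite mul1r /logq -!/(lg _) l1 l2 expr0n /= addr0.
move/esym/eqP; rewrite mulf_eq0 (gt_eqF Q0) orbF paddr_eq0 ?sqr_ge0 //.
by rewrite !sqrf_eq0 !intr_eq0 => /andP[/eqP-> /eqP->].
Qed.

(** * The root r and the relative unit built from it *)

Hypothesis r_int : int_ r.
Hypothesis r_norm : r * sg (sg r) = - e0.
Hypothesis r_trace : r + sg (sg r) =
  - 2 * ((S ^+ 3 - S ^+ 2 + 2 * S - 1) + (S ^+ 2 - S + 1) * w).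

Local Notation mm := (m%:~R : M).

Lemma hmM : 3 * S ^+ 2 - 4 * S + 4 = mm ^+ 2.
Proof. by transitivity ((3 * s ^+ 2 - 4 * s + 4)%:~R : M); [ring | rewrite hm; ring]. Qed.

(* delta * e0 is a quarter of the discriminant of the factor of F_s over k
   that has the root r. *)
Definition delta : M :=
  (S ^+ 2 + 2) * (S ^+ 2 - 2 * S + 2) + (S - 1) * (S ^+ 2 - S + 2) * w.

Lemma sg_delta : sg delta =
  (S ^+ 2 + 2) * (S ^+ 2 - 2 * S + 2) - (S - 1) * (S ^+ 2 - S + 2) * w.
Proof.
rewrite /delta !(rmorphD, rmorphB, rmorphM, rmorphXn) /= !rmorph_int rmorph1 sgw.
by ring.
Qed.

Lemma trace_sqr : (r + sg (sg r)) ^+ 2 = 4 * (delta - 1) * e0.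
Proof.
rewrite r_trace /delta /e0; move: w2 => /eqP; rewrite -subr_eq0 => /eqP w2'.
apply/eqP; rewrite -subr_eq0; apply/eqP.
transitivity ((w ^+ 2 - (S ^+ 2 + 2)) *
   (4 * (S ^+ 2 - S + 1) ^+ 2 - 4 * (S - 1) * (S ^+ 2 - S + 2) * S)); last by rewrite w2' mul0r.
ring.
Qed.

Lemma delta_norm : delta * sg delta = mm ^+ 2 * (S ^+ 2 + 2).
Proof.
rewrite sg_delta /delta -hmM.
transitivity (((S ^+ 2 + 2) * (S ^+ 2 - 2 * S + 2)) ^+ 2 - ((S - 1) * (S ^+ 2 - S + 2)) ^+ 2 * w ^+ 2).
  by ring.
rewrite w2; ring.
Qed.

Lemma r_neq0 : r != 0.
Proof.
by apply/eqP => h; move/eqP: r_norm; rewrite h mul0r eq_sym oppr_eq0 (negPf e0_neq0).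
Qed.

Lemma sgr_norm : sg r * sg (sg (sg r)) = - sg e0.
Proof. by rewrite -rmorphM r_norm rmorphN. Qed.

Lemma r_prod : r * sg r * sg (sg r) * sg (sg (sg r)) = 1.
Proof.
transitivity ((r * sg (sg r)) * (sg r * sg (sg (sg r)))); first by ring.
by rewrite r_norm sgr_norm mulrNN e0_sg.
Qed.

Lemma unit_r : integral_unit r.
Proof.
have i1 := integral_morph sg r_int; have i2 := integral_morph sg i1.
have i3 := integral_morph sg i2.
apply: (@integral_unit_mulV _ r (sg r * sg (sg r) * sg (sg (sg r)))) => //.
  by apply: integral_mul => //; apply: integral_mul.
by rewrite !mulrA r_prod.
Qed.

(** This is r raised to 1 + i. Its relative norm is the full norm 1 of r, and up to sign its
    Gaussian powers are exactly the relative units among the products of conjugates of r. *)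
Definition rho : M := r * sg r.

Lemma rel_unit_rho : rel_unit rho.
Proof.
split; first by apply: integral_unitM; [|apply: integral_unit_morph]; exact: unit_r.
by left; rewrite /rho !rmorphM -r_prod; ring.
Qed.

Lemma phi_e0_gt0 : 0 < phi e0.
Proof.
have h1 : phi e0 * phi (sg e0) = 1 by rewrite -rmorphM e0_sg rmorph1.
have h2 : phi e0 + phi (sg e0) = 2 * (s%:~R ^+ 2 + 1).
  rewrite -rmorphD sg_e0 /e0.
  have -> : S ^+ 2 + 1 + S * w + (S ^+ 2 + 1 - S * w) = 2 * (S ^+ 2 + 1) by ring.
  by rewrite rmorphM rmorph_nat rmorphD rmorphXn rmorph_int rmorph1.
have := sqr_ge0 (s%:~R : R); nra.
Qed.

(** If rho = +-1 then g^2 r = +-r. The plus sign gives r^2 = -e0, negative in the real embedding;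
    the minus sign gives trace 0, so delta = 1 and m^2 D = 1. *)
Lemma rho_nontrivial : nontrivial rho.
Proof.
split; first exact: rel_unit_rho.
move=> h; have h2 : (sg (sg r)) ^+ 2 = r ^+ 2.
  have h1 : (sg r * sg (sg r)) ^+ 2 = 1 by rewrite -rmorphM -rmorphXn h rmorph1.
  apply: (mulfI (expf_neq0 2 (sg_neq0 r_neq0))); rewrite -!exprMn h1.
  by rewrite mulrC -/rho h.
have h3 : (r * sg (sg r)) ^+ 2 = r ^+ 2 * r ^+ 2 by rewrite exprMn h2.
have /eqP : (sg (sg r)) ^+ 2 = r ^+ 2 by [].
rewrite eqf_sqr => /orP[/eqP h4|/eqP h4].
  have := r_norm; rewrite h4 => /(congr1 phi); rewrite rmorphM rmorphN => h5.
  by have := phi_e0_gt0; have := sqr_ge0 (phi r); rewrite expr2 h5; lra.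
have : delta = 1.
  have := trace_sqr; rewrite h4 subrr expr0n /= => /esym/eqP.
  rewrite !mulf_eq0 (negPf e0_neq0) orbF subr_eq0 => /orP[|/eqP //].
  by rewrite -(fmorph_eq0 phi) rmorph_nat pnatr_eq0.
move=> d1; have h5 : m ^+ 2 * D = 1.
  by apply: intrM_inj; rewrite intrM DE rmorphXn /= -delta_norm d1 rmorph1 mulr1.
have s12 := s_ge12; have := sqr_ge0 m; nia.
Qed.

(** The parallelogram identity gives 2 Q(rho) = ln^2 |r / g^2 r| + ln^2 |g r / g^3 r|. Each ratio t
    satisfies t + 1/t = -(4 delta - 2) or its conjugate, so [ln_delta_bound] yields 17 z^2 / 2. *)
Lemma logq_rho : logq rho < 9 * z ^+ 2.
Proof.
have r0 := r_neq0; have r1 := sg_neq0 r0; have r2 := sg_neq0 r1; have r3 := sg_neq0 r2.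
have dn : phi delta * phi (sg delta) = (3 * s%:~R ^+ 2 - 4 * s%:~R + 4) * (s%:~R ^+ 2 + 2).
  rewrite -rmorphM delta_norm -hmM.
  by rewrite !(rmorphD, rmorphB, rmorphM, rmorphXn) /= !rmorph_int rmorph1; ring.
have dt : phi delta + phi (sg delta) =
    2 * ((s%:~R ^+ 2 + 2) * (s%:~R ^+ 2 - 2 * s%:~R + 2)).
  rewrite -rmorphD sg_delta /delta addrACA subrr addr0.
  by rewrite !(rmorphD, rmorphB, rmorphM, rmorphXn) /= !rmorph_int rmorph1; ring.
have c12 : 12 <= `|s|%:~R :> R by have := s_ge12; rewrite -(ler_int R).
have uc : (s%:~R : R) ^+ 2 = `|s|%:~R ^+ 2 by rewrite intr_norm real_normK ?num_real.
have [d0 d1] : 0 < phi delta /\ 0 < phi (sg delta).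
  have : 0 < phi delta * phi (sg delta).
    by rewrite dn mulr_gt0 //; have := sqr_ge0 (s%:~R : R); nra.
  have : 0 < phi delta + phi (sg delta).
    by rewrite dt !mulr_gt0 //; have := sqr_ge0 (s%:~R : R); nra.
  by move: (phi delta) (phi (sg delta)) => p q; nra.
have tE : r / sg (sg r) + (r / sg (sg r))^-1 = - (4 * delta - 2).
  have -> : r / sg (sg r) + (r / sg (sg r))^-1 =
      ((r + sg (sg r)) ^+ 2 - 2 * (r * sg (sg r))) / (r * sg (sg r)).
    by field; rewrite r0 r2.
  have eN : - e0 != 0 by rewrite oppr_eq0 e0_neq0.
  by apply: (mulIf eN); rewrite trace_sqr r_norm divfK //; ring.
have tE1 : sg r / sg (sg (sg r)) + (sg r / sg (sg (sg r)))^-1 = - (4 * sg delta - 2).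
  have := congr1 sg tE.
  by rewrite !(rmorphD, rmorphN, rmorphB, rmorphM, fmorphV) /= !rmorph1.
have [a1 h0] : 1 <= phi delta /\ `|phi (r / sg (sg r))| + `|phi (r / sg (sg r))|^-1 <= 4 * phi delta.
  apply: recip_trace_bound => //; first by rewrite fmorph_eq0 mulf_neq0 ?invr_eq0.
  by rewrite -(fmorphV phi) -(rmorphD phi) tE rmorphN rmorphB rmorphM !rmorph_nat.
have [b1 h1] : 1 <= phi (sg delta) /\ `|phi (sg r / sg (sg (sg r)))| + `|phi (sg r / sg (sg (sg r)))|^-1 <= 4 * phi (sg delta).
  apply: recip_trace_bound => //; first by rewrite fmorph_eq0 mulf_neq0 ?invr_eq0.
  by rewrite -(fmorphV phi) -(rmorphD phi) tE1 rmorphN rmorphB rmorphM !rmorph_nat.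
have := ln_delta_bound c12 uc a1 b1 dt dn.
have := ln_sqr_le (nphi_gt0 _) h0; have := ln_sqr_le (nphi_gt0 _) h1.
rewrite !mulf_neq0 ?invr_eq0 // => /(_ isT) g1 /(_ isT) g0.
rewrite -!/(lg _) !lgM ?invr_eq0 // !lgV // in g0 g1.
have E0 : lg r + lg (sg (sg r)) = lg e0 by rewrite -lgM // r_norm lgN.
have E1 : lg (sg r) + lg (sg (sg (sg r))) = - lg e0.
  by rewrite -lgM // sgr_norm lgN sgeV lgV ?e0_neq0.
have Q : 2 * logq rho = (lg r - lg (sg (sg r))) ^+ 2 + (lg (sg r) - lg (sg (sg (sg r)))) ^+ 2.
  rewrite /logq -!/(lg _) /rho rmorphM !lgM //.
  have -> : lg (sg (sg r)) = lg e0 - lg r by rewrite -E0; ring.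
  have -> : lg (sg (sg (sg r))) = - lg e0 - lg (sg r) by rewrite -E1; ring.
  ring.
have zz : 0 < z ^+ 2 by rewrite exprn_gt0 ?z_gt0.
by move: g0 g1 Q zz; lra.
Qed.

Lemma e0_sqr_neq1 : e0 ^+ 2 <> 1.
Proof.
move=> h; have e : sg e0 = e0 by apply: (mulfI e0_neq0); rewrite e0_sg -expr2 h.
have : (2 : M) * S * w = 0.
  by have : e0 - sg e0 = 0 by [rewrite e subrr]; rewrite sg_e0 /e0 => <-; ring.
move/eqP; rewrite !mulf_eq0 (negPf two_neq0) (negPf w_neq0) orbF /=.
rewrite -(fmorph_eq0 phi) rmorph_int intr_eq0.
by move/eqP=> s00; move: s0; rewrite s00 eqxx.
Qed.

Lemma lg_e0_neq0 : lg e0 != 0.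
Proof. by apply/eqP => /(lg_eq0 e0_neq0); exact: e0_sqr_neq1. Qed.

Lemma lg_rel_norm x : rel_unit x -> lg (x * sg (sg x)) = 0.
Proof. by case=> _ [] ->; rewrite ?lgN lg1. Qed.

(** Otherwise v = r / x satisfies v g v = +-1, so g^2 v = v and v = +-e0^n. Taking logarithms of
    relative norms, the norm -e0 of r gives 1 = 2 n. *)
Lemma rho_not_mul_sg x : rel_unit x -> rho ^+ 2 <> (x * sg x) ^+ 2.
Proof.
move=> rx h; have x0 := rel_unit_neq0 rx; have r0 := r_neq0.
have [v uv rv] : exists2 v, integral_unit v & r = v * x.
  exists (r / x); last by rewrite divfK.
  by apply: integral_unitM; [exact: unit_r | apply: integral_unitV; case: rx].
have v0 : v != 0 by case: uv.
have vv : (v * sg v) ^+ 2 = 1.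
  have x1 : (x * sg x) ^+ 2 != 0 by rewrite expf_neq0 ?mulf_neq0 ?sg_neq0.
  apply: (mulIf x1); rewrite mul1r -[RHS]h /rho rv rmorphM -exprMn; congr (_ ^+ 2); ring.
have v2 : sg (sg v) = v.
  apply: (mulIf (sg_neq0 v0)); rewrite -rmorphM mulrC [_ * sg v]mulrC.
  by rewrite [sg v * v]mulrC; case: (sqr_eq1 vv) => ->; rewrite ?rmorphN rmorph1.
have [n hn] := unit_quadfix uv v2.
have lv : lg v = n%:~R * lg e0 by case: hn => ->; rewrite ?lgN lgX ?e0_neq0.
have : lg (r * sg (sg r)) = lg e0 by rewrite r_norm lgN.
rewrite rv !rmorphM v2 mulrACA lgM ?mulf_neq0 ?sg_neq0 // lg_rel_norm // addr0 lgM // lv.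
move=> e; have : (n%:~R + n%:~R - 1) * lg e0 = 0 by rewrite mulrBl mulrDl e mul1r subrr.
move/eqP; rewrite mulf_eq0 (negPf lg_e0_neq0) orbF subr_eq0 -intrD (eqr_int R (n + n) 1).
lia.
Qed.

(** * The index of the group generated by the roots *)

Lemma gpow_sqr x a b : gpow x a b ^+ 2 = (x ^+ 2) ^ a * ((sg x) ^+ 2) ^ b.
Proof. by rewrite /gpow exprMn !exprz_sqr. Qed.

(** Iterated exponents multiply as (c + d i) (a + b i). The rule i^2 = -1 holds only up to sign on
    relative units, hence the squares. *)
Lemma gpow_gpow x y a b c d : rel_unit y -> x ^+ 2 = gpow y c d ^+ 2 ->
  gpow x a b ^+ 2 = gpow y (c * a - d * b) (d * a + c * b) ^+ 2.
Proof.
move=> ry h; have y0 := rel_unit_neq0 ry.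
have h1 : (sg x) ^+ 2 = ((sg y) ^+ 2) ^ c * ((y ^+ 2)^-1) ^ d.
  by rewrite -rmorphXn h rmorphXn sg_gpow gpow_sqr; case/rel_unit_sqr: ry => _ ->.
rewrite gpow_sqr h h1 !gpow_sqr.
move: (expf_neq0 2 y0) (expf_neq0 2 (sg_neq0 y0)).
move: (y ^+ 2) (sg y ^+ 2) => U V U0 V0.
rewrite !expfzMl !exprz_inv !exprz_exp !expfzDr // mulNr.
by set E := _ ^ (- (d * b)); ring.
Qed.

(* Comparing squares absorbs the generator -1. *)
Definition root_group (h : M) : Prop := exists a b c d : int,
  h ^+ 2 = (r ^ a * sg r ^ b * sg (sg r) ^ c * sg (sg (sg r)) ^ d) ^+ 2.

Theorem unit_index : exists n : nat, (n = 1%N \/ n = 5%N) /\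
  exists reps : 'I_n -> M,
    [/\ forall i, integral_unit (reps i),
        forall u, integral_unit u -> exists i, exists2 h, root_group h & u = reps i * h &
        forall i j, (exists2 h, root_group h & reps i = reps j * h) -> i = j].
Proof.
have [y ny hy] := minimal_rel_unit rho_nontrivial.
have [ry _] := ny; have y0 := rel_unit_neq0 ry; have r0 := r_neq0.
have [c [d hcd]] := minimal_generates ny hy rel_unit_rho.
have Q0 : z ^+ 2 <= logq y := nontrivial_logq ny.
have zz : 0 < z ^+ 2 by rewrite exprn_gt0 ?z_gt0.
have QE : logq rho = (c ^+ 2 + d ^+ 2)%:~R * logq y.
  have -> : logq rho = logq (1 * gpow y c d).
    rewrite mul1r /logq -!/(lg _) (lg_sqr hcd).
    by have := congr1 sg hcd; rewrite !rmorphXn => /lg_sqr ->.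
  rewrite logq_gpow ?oner_neq0 // rmorph1 lg1 /logq -!/(lg _) intrD !rmorphXn /=; ring.
have n9 : c ^+ 2 + d ^+ 2 < 9.
  rewrite -(ltr_int R); have := logq_rho; rewrite QE.
  move: (_%:~R) => N; rewrite ltNge => h; rewrite ltNge; apply/negP => N9.
  move/negP: h; apply; apply: (@le_trans _ _ (9 * logq y)); first by rewrite ler_wpM2l.
  by rewrite ler_wpM2r //; lra.
(* c + d = 2 k means c + d i = (1 + i) (k + (k - c) i), and raising to 1 + i is x -> x g x. *)
have odd : forall k, c + d <> 2 * k.
  move=> k hk; have dE : d = 2 * k - c by rewrite -hk; ring.
  apply: (@rho_not_mul_sg (gpow y k (k - c))); first exact: rel_unit_gpow.
  rewrite hcd; have := @gpow_gpow (gpow y k (k - c)) y 1 1 k (k - c) ry erefl.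
  rewrite {1}/gpow !expr1z => ->; congr (gpow _ _ _ ^+ 2); rewrite ?dE; ring.
have n15 := sum_sqr_odd n9 odd.
have [N nn] : exists N : nat, c ^+ 2 + d ^+ 2 = N%:Z.
  by exists (absz (c ^+ 2 + d ^+ 2)); rewrite gez0_abs // addr_ge0 ?sqr_ge0.
have N15 : N = 1%N \/ N = 5%N by move: n15; rewrite nn; lia.
exists N; split=> //.
exists (fun i => y ^+ i); split.
- by move=> i; apply: (integral_unitX i%:Z); case: ry.
- move=> u uu; have u0 : u != 0 by case: uu.
  have [k hk] : exists k : int, u * sg (sg u) = e0 ^ k \/ u * sg (sg u) = - e0 ^ k.
    apply: unit_quadfix; last by rewrite !rmorphM sg4 mulrC.
    by apply: integral_unitM => //; do 2 apply: integral_unit_morph.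
  have rt : rel_unit (u * r ^ (- k)).
    apply/rel_unit_sqr; split; first by apply: integral_unitM => //; apply: integral_unitX; exact: unit_r.
    have t0 : u * r ^ (- k) != 0 by rewrite mulf_neq0 ?expfz_neq0.
    apply: (mulfI (expf_neq0 2 t0)); rewrite mulfV ?expf_neq0 // -exprMn.
    rewrite !rmorphM !fmorphXz mulrACA -expfzMl r_norm exprMn.
    have -> : (u * sg (sg u)) ^+ 2 = (e0 ^+ 2) ^ k by case: hk => ->; rewrite ?sqrrN exprz_sqr.
    by rewrite exprz_sqr sqrrN -expfzDr ?expf_neq0 ?e0_neq0 // subrr expr0z.
  have [a [b hab]] := minimal_generates ny hy rt.
  have [A [B [j [j0 jn ae be]]]] := gauss_residue n15 a b.
  have jlt : (absz j < N)%N by move: j0 jn; rewrite nn; clear; lia.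
  have jE : (absz j)%:Z = j by rewrite gez0_abs.
  exists (Ordinal jlt); exists (y ^ (- j) * u); last first.
    by rewrite /= -[y ^+ _]/(y ^ (absz j)%:Z) jE mulrA -expfzDr // subrr expr0z mul1r.
  (* These are the exponents of r, g r, g^2 r, g^3 r in rho^A (g rho)^B r^k. *)
  exists (A + k), (A + B), B, 0.
  have -> : u = u * r ^ (- k) * r ^ k by rewrite -mulrA -expfzDr // addNr expr0z mulr1.
  have hr : gpow rho A B ^+ 2 = gpow y (c * A - d * B) (d * A + c * B) ^+ 2 := gpow_gpow A B ry hcd.
  rewrite expr0z mulr1 [in LHS]mulrA 2![in LHS]exprMn hab ae be -exprMn.
  have -> : y ^ (- j) * gpow y (j + (c * A - d * B)) (d * A + c * B) =
      gpow y (c * A - d * B) (d * A + c * B).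
    by rewrite /gpow mulrA -expfzDr // addKr.
  rewrite -hr -exprMn; congr (_ ^+ 2).
  rewrite /gpow /rho rmorphM !expfzMl !expfzDr ?sg_neq0 //; ring.
move=> i j [h [a [b [e [f hh]]]] ij].
have ij' : h = y ^ (i%:Z - j%:Z).
  apply: (mulfI (expf_neq0 j y0)); rewrite -ij -[RHS]/(y ^ j%:Z * _) -expfzDr //.
  by rewrite addrC subrK.
have rh : rel_unit h by rewrite ij'; exact: rel_unitX.
have h0 := rel_unit_neq0 rh.
have r1 := sg_neq0 r0; have r2 := sg_neq0 r1; have r3 := sg_neq0 r2.
(* As h is a power of y, its relative norm is +-1; in terms of the exponents the logarithm of that
   norm is (a - b + e - f) lg e0. *)
have abef : a - b + e - f = 0.
  have : lg (h * sg (sg h)) = 0 by exact: lg_rel_norm.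
  rewrite lgM ?sg_neq0 //.
  have := congr1 (fun x => sg (sg x)) hh; rewrite !rmorphXn !rmorphM !fmorphXz sg4 => /lg_sqr ->.
  rewrite (lg_sqr hh) !lgM ?mulf_neq0 ?expfz_neq0 ?sg_neq0 // !lgX ?sg_neq0 //.
  have E0 : lg r + lg (sg (sg r)) = lg e0 by rewrite -lgM // r_norm lgN.
  have E1 : lg (sg r) + lg (sg (sg (sg r))) = - lg e0.
    by rewrite -lgM // sgr_norm lgN sgeV lgV ?e0_neq0.
  move=> l0.
  have : (a - b + e - f)%:~R * lg e0 = 0.
    rewrite -l0 !intrD !intrN.
    have -> : lg (sg (sg r)) = lg e0 - lg r by rewrite -E0; ring.
    have -> : lg (sg (sg (sg r))) = - lg e0 - lg (sg r) by rewrite -E1; ring.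
    ring.
  by move/eqP; rewrite mulf_eq0 (negPf lg_e0_neq0) orbF intr_eq0 => /eqP.
(* Eliminating g^3 r through the norm relation and e through [abef] leaves a Gaussian power of
   rho. *)
have hg : h ^+ 2 = gpow rho (a - f) (b - a) ^+ 2.
  rewrite hh; congr (_ ^+ 2).
  have -> : sg (sg (sg r)) = (r * sg r * sg (sg r))^-1.
    by apply: (mulfI (mulf_neq0 (mulf_neq0 r0 r1) r2)); rewrite r_prod mulfV ?mulf_neq0.
  have -> : e = b - a + f by lia.
  rewrite /gpow /rho rmorphM exprz_inv !expfzMl !expfzDr ?sg_neq0 // -!invr_expz.
  by field; rewrite !expfz_neq0.
have hr : gpow rho (a - f) (b - a) ^+ 2 = _ := gpow_gpow (a - f) (b - a) ry hcd.
rewrite hr in hg; move: hg hr.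
set A := a - f; set B := b - a => hg _.
have [e1 e2] : c * A - d * B - (i%:Z - j%:Z) = 0 /\ d * A + c * B = 0.
  apply: (gpow_inj ny); rewrite addrC.
  have -> : d * A + c * B = 0 + (d * A + c * B) by rewrite add0r.
  rewrite gpowD // exprMn -hg ij' {1}/gpow expr0z mulr1 -exprMn -expfzDr //.
  by rewrite addNr expr0z expr1n.
(* Taking Gaussian norms in i - j = (c + d i) (A + B i). A square below 25 that is divisible by 5
   vanishes; for N = 1 there is a single index. *)
have : (i%:Z - j%:Z) ^+ 2 = (c ^+ 2 + d ^+ 2) * (A ^+ 2 + B ^+ 2).
  have -> : (c ^+ 2 + d ^+ 2) * (A ^+ 2 + B ^+ 2) = (c * A - d * B) ^+ 2 + (d * A + c * B) ^+ 2 by ring.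
  by rewrite e2 expr0n addr0; move/eqP: e1; rewrite subr_eq0 => /eqP ->.
move=> ij2; apply: ord_inj; move: ij2; have := ltn_ord i; have := ltn_ord j.
move: (nat_of_ord i) (nat_of_ord j) (A ^+ 2 + B ^+ 2) => p q T.
rewrite nn; case: N15 => -> qn pn hpq; first by lia.
have : p%:Z - q%:Z = 0 \/ p%:Z - q%:Z = 1 \/ p%:Z - q%:Z = 2 \/ p%:Z - q%:Z = 3 \/ p%:Z - q%:Z = 4 \/
  p%:Z - q%:Z = -1 \/ p%:Z - q%:Z = -2 \/ p%:Z - q%:Z = -3 \/ p%:Z - q%:Z = -4 by lia.
case=> [|[|[|[|[|[|[|[|]]]]]]]] k; rewrite k in hpq; lia.
Qed.

End Core.

(** * Generated groups and quartic polynomials *)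

Section GeneratedGroup.
Variables (L : fieldExtType rat) (gens : seq L).
Hypothesis gens0 : 0 \notin gens.

Lemma nth_gens_neq0 (i : 'I_(size gens)) : gens`_i != 0.
Proof. by apply: contra gens0 => /eqP <-; exact: mem_nth. Qed.

Lemma in_gen_groupM (x y : L) :
  in_gen_group gens x -> in_gen_group gens y -> in_gen_group gens (x * y).
Proof.
case=> ks [sk ->] [ls [sl ->]].
exists (mkseq (fun i => ks`_i + ls`_i) (size gens)); rewrite size_mkseq; split=> //.
rewrite -big_split; apply: eq_bigr => i _ /=.
by rewrite nth_mkseq // expfzDr ?nth_gens_neq0.
Qed.

Lemma in_gen_groupX (x : L) (n : int) : in_gen_group gens x -> in_gen_group gens (x ^ n).
Proof.
case=> ks [sk ->]; exists (mkseq (fun i => ks`_i * n) (size gens)).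
rewrite size_mkseq; split=> //.
have prodz (I : Type) (s : seq I) (F : I -> L) : (\prod_(i <- s) F i) ^ n = \prod_(i <- s) F i ^ n.
  elim: s => [|i s ih]; first by rewrite !big_nil exp1rz.
  by rewrite !big_cons expfzMl ih.
rewrite prodz; apply: eq_bigr => i _.
by rewrite nth_mkseq // exprz_exp.
Qed.

Lemma mem_in_gen_group (x : L) : x \in gens -> in_gen_group gens x.
Proof.
move=> xg; exists (mkseq (fun i => (i == index x gens)%:Z) (size gens)).
rewrite size_mkseq; split=> //.
have ix : (index x gens < size gens)%N by rewrite index_mem.
rewrite (bigD1 (Ordinal ix)) //= nth_mkseq // eqxx expr1z nth_index //.
rewrite big1 ?mulr1 // => i ni; rewrite nth_mkseq //.
by have -> : (nat_of_ord i == index x gens) = false by apply/negbTE; apply: contra ni => /eqP e; apply/eqP/val_inj.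
Qed.

Lemma in_gen_group_ind (P : L -> Prop) : P 1 ->
  (forall x y, P x -> P y -> P (x * y)) ->
  (forall x (n : int), x \in gens -> P (x ^ n)) ->
  forall x, in_gen_group gens x -> P x.
Proof.
move=> P1 PM PX x [ks [_ ->]]; apply: big_ind => // i _.
by apply: PX; exact: mem_nth.
Qed.

End GeneratedGroup.

(** * Symmetric functions of the roots of a quartic *)

Section VietaQuartic.
Variable F : fieldType.
Implicit Types c a b x y d : F.

Lemma vieta4 c3 c2 c1 c0 a b c d :
  'X^4 + c3%:P * 'X^3 + c2%:P * 'X^2 + c1%:P * 'X + c0%:P =
    \prod_(r <- [:: a; b; c; d]) ('X - r%:P) ->
  [/\ a + b + c + d = - c3, a * b + a * c + a * d + b * c + b * d + c * d = c2,
      a * b * c + a * b * d + a * c * d + b * c * d = - c1 & a * b * c * d = c0].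
Proof.
rewrite !big_cons big_nil mulr1 => h.
have h' : ('X : {poly F})^+4 + c3%:P * 'X^3 + c2%:P * 'X^2 + c1%:P * 'X + c0%:P =
  'X^4 + (- (a + b + c + d))%:P * 'X^3
  + (a * b + a * c + a * d + b * c + b * d + c * d)%:P * 'X^2
  + (- (a * b * c + a * b * d + a * c * d + b * c * d))%:P * 'X
  + (a * b * c * d)%:P.
  rewrite h !(polyCN, polyCD, polyCM); ring.
have co k := congr1 (fun p : {poly F} => p`_k) h'.
have := co 0%N; have := co 1%N; have := co 2; have := co 3.
rewrite !coefD !coefCM !coefXn !coefX !coefC /= !(mulr0, mulr1, addr0, add0r).
by move=> e3 e2 e1 e0; rewrite e0 e1 e2 e3 !opprK.
Qed.

(** The left-hand side is the cubic resolvent evaluated at k; its roots are the three pairing sums,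
    so a known root singles out a pairing of the four roots. *)
Lemma resolvent4 a b c d k :
  let e1 := a + b + c + d in
  let e2 := a * b + a * c + a * d + b * c + b * d + c * d in
  let e3 := a * b * c + a * b * d + a * c * d + b * c * d in
  let e4 := a * b * c * d in
  k ^+ 3 - e2 * k ^+ 2 + (e1 * e3 - 4 * e4) * k - (e3 ^+ 2 + e1 ^+ 2 * e4 - 4 * e2 * e4) = 0 ->
  [\/ a * c + b * d = k, a * b + c * d = k | a * d + b * c = k].
Proof.
move=> e1 e2 e3 e4 h.
have : (k - (a * c + b * d)) * (k - (a * b + c * d)) * (k - (a * d + b * c)) = 0.
  by rewrite -h /e1 /e2 /e3 /e4; ring.
move/eqP; rewrite !mulf_eq0 !subr_eq0 => /orP[/orP[]|] /eqP ->.
- by apply: Or31.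
- by apply: Or32.
- by apply: Or33.
Qed.

End VietaQuartic.

Section FsRoots.
Variables (F : fieldType) (S m : F).
Hypothesis two0 : (2 : F) != 0.
Hypothesis q0 : S ^+ 2 - S + 1 != 0.
Hypothesis D0 : S ^+ 2 + 2 != 0.
Local Notation p := (S ^+ 3 - S ^+ 2 + 2 * S - 1).
Local Notation q := (S ^+ 2 - S + 1).

(* The cubic resolvent has the rational root -2 (S^2 + 1). *)
Lemma Fs_pairing (a b c d : F) :
  a + b + c + d = - (4 * S ^+ 3 - 4 * S ^+ 2 + 8 * S - 4) ->
  a * b + a * c + a * d + b * c + b * d + c * d = - 6 * S ^+ 2 - 6 ->
  a * b * c + a * b * d + a * c * d + b * c * d = - 4 -> a * b * c * d = 1 ->
  exists r0 r1 r2 r3 w, [/\ [:: r0; r1; r2; r3] =i [:: a; b; c; d],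
    w ^+ 2 = S ^+ 2 + 2, r0 + r2 = - 2 * (p + q * w), r1 + r3 = - 2 * (p - q * w) &
    r0 * r2 = - (S ^+ 2 + 1 + S * w) /\ r1 * r3 = - (S ^+ 2 + 1 - S * w)].
Proof.
move=> e1 e2 e3 e4.
have [r0 [r1 [r2 [r3 [im s1 s2 s3 s4]]]]] : exists r0 r1 r2 r3,
    [/\ [:: r0; r1; r2; r3] =i [:: a; b; c; d],
      r0 * r2 + r1 * r3 = - 2 * (S ^+ 2 + 1),
      r0 + r1 + r2 + r3 = - (4 * S ^+ 3 - 4 * S ^+ 2 + 8 * S - 4),
      r0 * r1 + r0 * r2 + r0 * r3 + r1 * r2 + r1 * r3 + r2 * r3 = - 6 * S ^+ 2 - 6 &
      r0 * r1 * r2 + r0 * r1 * r3 + r0 * r2 * r3 + r1 * r2 * r3 = - 4].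
  have := @resolvent4 F a b c d (- 2 * (S ^+ 2 + 1)); rewrite /= e1 e2 e3 e4.
  case=> [|h|h|h]; first by ring.
  - by exists a, b, c, d; split.
  - exists a, c, b, d; split; rewrite -?h -?e1 -?e2 -?e3; try ring.
    by move=> x; rewrite !inE; case: (x == a); case: (x == b); case: (x == c); case: (x == d).
  - exists a, b, d, c; split; rewrite -?h -?e1 -?e2 -?e3; try ring.
    by move=> x; rewrite !inE; case: (x == a); case: (x == b); case: (x == c); case: (x == d).
have four0 : (4 : F) != 0.
  by have -> : (4 : F) = 2 * 2 by [ring]; rewrite mulf_neq0.
(* w is read off from the sum r0 + r2. The second symmetric function then gives w^2, and the third
   one separates r0 r2 from r1 r3. *)
have [w wE] : exists w, w = - (r0 + r2 + 2 * p) / (2 * q) by eexists.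
have t02 : r0 + r2 = - 2 * (p + q * w) by rewrite wE; field; rewrite two0 q0.
have t13 : r1 + r3 = - 2 * (p - q * w).
  have -> : r1 + r3 = (r0 + r1 + r2 + r3) - (r0 + r2) by ring.
  by rewrite s2 t02; ring.
have w2 : w ^+ 2 = S ^+ 2 + 2.
  have h : (r0 + r2) * (r1 + r3) = (- 6 * S ^+ 2 - 6) - - 2 * (S ^+ 2 + 1).
    by rewrite -s1 -s3; ring.
  rewrite t02 t13 in h.
  have c0 : 4 * q ^+ 2 != 0.
    by rewrite mulf_eq0 negb_or four0 expf_neq0.
  apply: (mulfI c0); transitivity (4 * p ^+ 2 - (- 2 * (p + q * w)) * (- 2 * (p - q * w))).
    by ring.
  by rewrite h; ring.
have w0 : w != 0 by apply: contra D0 => /eqP w0; rewrite -w2 w0 expr0n.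
have N02 : r0 * r2 = - (S ^+ 2 + 1 + S * w).
  have h : r0 * r2 * (r1 + r3) + (r1 * r3) * (r0 + r2) = - 4 by rewrite -s4; ring.
  have e13 : r1 * r3 = - 2 * (S ^+ 2 + 1) - r0 * r2 by rewrite -s1; ring.
  have c0 : 4 * q * w != 0.
    by rewrite !mulf_eq0 !negb_or four0 q0 w0.
  apply: (mulfI c0); rewrite t02 t13 e13 in h; move: (r0 * r2) h => N h.
  have h2 : 4 * q * w * N = - 4 - 4 * (S ^+ 2 + 1) * (p + q * w) by rewrite -h; ring.
  rewrite h2.
  transitivity (- 4 - 4 * (S ^+ 2 + 1) * (p + q * w) + 4 * q * S * (S ^+ 2 + 2 - w ^+ 2)).
    by rewrite w2 subrr mulr0 addr0.
  by ring.
exists r0, r1, r2, r3, w; split=> //; split=> //.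
by have -> : r1 * r3 = - 2 * (S ^+ 2 + 1) - r0 * r2 by [rewrite -s1; ring]; rewrite N02; ring.
Qed.

End FsRoots.

(** * A real embedding of the splitting field *)

Section Embedding.
Variables (L : fieldExtType rat) (K : {subfield L}) (F : {poly rat}) (x : L).
Variables (R : numFieldType) (t : R).
Hypothesis Kx : {subset K <= <<1; x>>%VS}.
Hypothesis minF : minPoly 1 x = map_poly (in_alg L) F.
Hypothesis Ft : root (map_poly ratr F) t.

Lemma embedding_poly (v : subvs_of K) :
  exists P : {poly rat}, vsval v == (map_poly (in_alg L) P).[x].
Proof. by have /Kx/Fadjoin1_polyP[P ->] := subvsP v; exists P. Qed.

(** P(x) goes to P(t) for a chosen P. The choice is harmless, because two candidates differ by a
    multiple of the minimal polynomial F, which vanishes at t. *)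
Definition embedding (v : subvs_of K) : R :=
  (map_poly ratr (xchoose (embedding_poly v))).[t].

Lemma embeddingE (v : subvs_of K) (P : {poly rat}) :
  vsval v = (map_poly (in_alg L) P).[x] -> embedding v = (map_poly ratr P).[t].
Proof.
rewrite /embedding => vP; have /eqP := xchooseP (embedding_poly v).
set Q := xchoose _; rewrite vP => PQ.
apply/eqP; rewrite -subr_eq0 -hornerN -hornerD -rmorphN -rmorphD.
have : F %| Q - P.
  rewrite -(dvdp_map (in_alg L)) -minF; apply: minPoly_dvdp; first exact: alg_polyOver.
  by rewrite /root rmorphB /= hornerD hornerN PQ subrr.
by case/dvdpP => U ->; rewrite rmorphM hornerM (eqP Ft) mulr0.
Qed.

Lemma embedding_zmod_morphism : zmod_morphism embedding.
Proof.
move=> u v; have /eqP up := xchooseP (embedding_poly u).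
have /eqP vp := xchooseP (embedding_poly v).
rewrite [embedding u]/embedding [embedding v]/embedding -hornerN -hornerD -rmorphN -rmorphD.
by apply: embeddingE; rewrite linearB /= {1}up {1}vp -hornerN -hornerD -rmorphN -rmorphD.
Qed.

Lemma embedding_monoid_morphism : monoid_morphism embedding.
Proof.
split; first by rewrite (embeddingE (P := 1)) ?rmorph1 ?hornerC.
move=> u v; have /eqP up := xchooseP (embedding_poly u).
have /eqP vp := xchooseP (embedding_poly v).
rewrite [embedding u]/embedding [embedding v]/embedding -hornerM -rmorphM.
by apply: embeddingE; rewrite [LHS]rmorphM /= {1}up {1}vp -hornerM -rmorphM.
Qed.

HB.instance Definition _ := GRing.isZmodMorphism.Build _ _ embedding embedding_zmod_morphism.
HB.instance Definition _ := GRing.isMonoidMorphism.Build _ _ embedding embedding_monoid_morphism.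
Definition embedding_rmorphism : {rmorphism subvs_of K -> R} := embedding.
End Embedding.

Section Restriction.
Variables (L : splittingFieldType rat) (K : {subfield L}) (g : gal_of K).

(** Products in [gal_of K] agree with composition of maps only on K, so an identity such as g^4 = 1
    becomes one for all elements only after restriction. *)
Definition gal_restr (v : subvs_of K) : subvs_of K := vsproj K (g (vsval v)).

Lemma gal_restrE v : vsval (gal_restr v) = g (vsval v).
Proof. by rewrite vsprojK ?memv_gal ?subvsP. Qed.

Lemma gal_restr_zmod_morphism : zmod_morphism gal_restr.
Proof. by move=> u v; apply: val_inj; rewrite /= gal_restrE !linearB /= !gal_restrE. Qed.

Lemma gal_restr_monoid_morphism : monoid_morphism gal_restr.
Proof.
split; first by apply: val_inj; rewrite /= gal_restrE /= algid1 rmorph1.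
by move=> u v; apply: val_inj; rewrite /= !gal_restrE /= rmorphM.
Qed.

HB.instance Definition _ := GRing.isZmodMorphism.Build _ _ gal_restr gal_restr_zmod_morphism.
HB.instance Definition _ := GRing.isMonoidMorphism.Build _ _ gal_restr gal_restr_monoid_morphism.
Definition gal_restr_rmorphism : {rmorphism subvs_of K -> subvs_of K} := gal_restr.
End Restriction.

(** A rational root would be an integer, and two squares of integers never differ by 2. *)
Lemma rat_sqr_neq (s : int) (a : rat) : a ^+ 2 != s%:~R ^+ 2 + 2.
Proof.
apply/eqP => h; have [z az] : exists z : int, a = z%:~R.
  apply: (@rat_sqr_int 1 a (s ^+ 2 + 2)); last by rewrite mul1r h intrD rmorphXn.
  move=> d d1; have : (d * d <= 1)%N by apply: dvdn_leq.
  by move: d1; case: d => [|[|d]].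
have : z ^+ 2 = s ^+ 2 + 2.
  by apply: (@intr_inj rat); rewrite intrD !rmorphXn /= -az h.
have sq (x : int) : exists2 u, 0 <= u & x ^+ 2 = u ^+ 2.
  have [x0|x0] := lerP 0 x; first by exists x.
  by exists (- x); rewrite ?sqrrN // oppr_ge0 ltW.
have [u u0 ->] := sq z; have [v v0 ->] := sq s => e.
have vu : v < u by nia.
have v00 : v = 0 by nia.
move: e; rewrite v00 => e; have [u2|u2] := lerP 2 u; first by nia.
have u1 : u = 1 by lia.
by rewrite u1 in e.
Qed.

Section RationalExtension.
Variable L : fieldExtType rat.

Lemma in_alg_ratr (a : rat) : in_alg L a = ratr a.
Proof. exact: (fmorph_eq_rat (in_alg L)). Qed.

Lemma intr_in_alg (n : int) : (n%:~R : L) = in_alg L n%:~R.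
Proof. by rewrite rmorph_int. Qed.

Lemma intr_ext_inj : injective (intr : int -> L).
Proof. by move=> a b; rewrite !intr_in_alg => /fmorph_inj /intr_inj. Qed.

Lemma intr_ext_eq0 (n : int) : ((n%:~R : L) == 0) = (n == 0).
Proof. by rewrite -(inj_eq intr_ext_inj). Qed.

End RationalExtension.

Lemma map_quartic (E F : fieldType) (f : {rmorphism E -> F}) (c3 c2 c1 : E) :
  map_poly f ('X^4 + c3%:P * 'X^3 + c2%:P * 'X^2 + c1%:P * 'X + 1) =
  'X^4 + (f c3)%:P * 'X^3 + (f c2)%:P * 'X^2 + (f c1)%:P * 'X + 1%:P.
Proof.
rewrite 4!(rmorphD (map_poly f)) (rmorphM (map_poly f) c3%:P).
rewrite (rmorphM (map_poly f) c2%:P) (rmorphM (map_poly f) c1%:P) /= !map_polyXn.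
by rewrite !map_polyC map_polyX /= rmorph1.
Qed.

Lemma horner_quartic (F : fieldType) (c3 c2 c1 c0 x : F) :
  ('X^4 + c3%:P * 'X^3 + c2%:P * 'X^2 + c1%:P * 'X + c0%:P).[x] =
  x ^+ 4 + c3 * x ^+ 3 + c2 * x ^+ 2 + c1 * x + c0.
Proof.
rewrite 4!hornerD (hornerM c3%:P) (hornerM c2%:P) (hornerM c1%:P) !hornerXn.
by rewrite hornerX !hornerC.
Qed.

Lemma map_Fs (F : fieldType) (f : {rmorphism rat -> F}) (s : int) : map_poly f (Fs s) =
  'X^4 + (4 * s%:~R ^+ 3 - 4 * s%:~R ^+ 2 + 8 * s%:~R - 4)%:P * 'X^3
   + (- 6 * s%:~R ^+ 2 - 6)%:P * 'X^2 + 4%:P * 'X + 1%:P.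
Proof.
rewrite /Fs map_quartic; congr (_ + _ * _ + _ * _ + _ * _ + _); congr polyC.
- by rewrite rmorph_int; ring.
- by rewrite rmorph_int; ring.
- exact: rmorph_nat.
Qed.

Lemma alg_integerE (L : fieldExtType rat) (x : L) :
  alg_integer x <-> integralOver (intr : int -> L) x.
Proof. by split=> [[p [mp rp]]|[p mp rp]]; exists p. Qed.

(** The factor t^2 + 2 b t - e0 over k has discriminant 4 (b^2 + e0), and e0 > 0 since e0 and its
    conjugate have product 1 and positive sum. *)
Lemma Fs_real_root (R : rcfType) (s : int) : exists t : R, root (map_poly ratr (Fs s)) t.
Proof.
pose S : R := s%:~R; pose w : R := Num.sqrt (S ^+ 2 + 2).
have w2 : w ^+ 2 = S ^+ 2 + 2 by rewrite sqr_sqrtr // addr_ge0 ?sqr_ge0.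
pose b : R := (S ^+ 3 - S ^+ 2 + 2 * S - 1) + (S ^+ 2 - S + 1) * w.
pose e : R := S ^+ 2 + 1 + S * w.
have e0 : 0 <= e.
  have h1 : e * (S ^+ 2 + 1 - S * w) = 1.
    transitivity ((S ^+ 2 + 1) ^+ 2 - S ^+ 2 * w ^+ 2); first by rewrite /e; ring.
    by rewrite w2; ring.
  have h2 : e + (S ^+ 2 + 1 - S * w) = 2 * (S ^+ 2 + 1) by rewrite /e; ring.
  by move: h1 h2 (sqr_ge0 S); move: (S ^+ 2 + 1 - S * w) => f; nra.
pose th := Num.sqrt (b ^+ 2 + e).
have th2 : th ^+ 2 = b ^+ 2 + e by rewrite sqr_sqrtr // addr_ge0 ?sqr_ge0.
exists (- b + th); rewrite /root map_Fs horner_quartic -/S.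
apply/eqP; transitivity (((- b + th) ^+ 2 + 2 * b * (- b + th) - e) *
    ((- b + th) ^+ 2 + 2 * ((S ^+ 3 - S ^+ 2 + 2 * S - 1) - (S ^+ 2 - S + 1) * w) * (- b + th)
       - (S ^+ 2 + 1 - S * w))); last first.
  have -> : (- b + th) ^+ 2 + 2 * b * (- b + th) - e = th ^+ 2 - (b ^+ 2 + e) by ring.
  by rewrite th2 subrr mul0r.
move: (- b + th) => x; apply/eqP; rewrite -subr_eq0; apply/eqP.
transitivity ((S ^+ 2 + 2 - w ^+ 2) * (- ((2 * (S ^+ 2 - S + 1) * x - S) ^+ 2)));
  last by rewrite w2 subrr mul0r.
rewrite /b /e. ring.
Qed.

(** * The splitting field *)

Section FsGalois.
Variables (s m : int) (L : splittingFieldType rat) (K : {subfield L}).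
Hypothesis hm : 3 * s ^+ 2 - 4 * s + 4 = m ^+ 2.
Hypothesis hK : splittingFieldFor 1%VS (map_poly (in_alg L) (Fs s)) K.
Local Notation FL := (map_poly (in_alg L) (Fs s)).
Local Notation S := (s%:~R : L).
Local Notation mm := (m%:~R : L).
Local Notation p := (S ^+ 3 - S ^+ 2 + 2 * S - 1).
Local Notation q := (S ^+ 2 - S + 1).

Lemma FsL_size : size FL = 5%N.
Proof.
rewrite map_Fs -!addrA size_polyDl ?size_polyXn //.
rewrite ltnS; apply/leq_sizeP => j; case: j => [|[|[|[|j]]]] // _.
by rewrite !coefD !coefCM !coefXn coefX !coefC /= !mulr0 !addr0.
Qed.

Lemma FsL_monic : FL \is monic.
Proof.
have := FsL_size; rewrite monicE lead_coefE => ->; rewrite map_Fs.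
by rewrite !coefD !coefCM !coefXn !coefX !coefC /= !(mulr0, addr0).
Qed.

Lemma q_neq0 : q != 0.
Proof.
have -> : q = (s ^+ 2 - s + 1)%:~R by ring.
by rewrite intr_ext_eq0; apply/eqP; nia.
Qed.

Lemma D_neq0 : S ^+ 2 + 2 != 0.
Proof.
have -> : S ^+ 2 + 2 = (s ^+ 2 + 2)%:~R by ring.
by rewrite intr_ext_eq0; apply/eqP; nia.
Qed.

Lemma m_neq0 : mm != 0.
Proof. by rewrite intr_ext_eq0; apply/eqP => m0; move: hm; rewrite m0; nia. Qed.

Lemma two_neq0L : (2 : L) != 0.
Proof. by rewrite (intr_ext_eq0 L 2). Qed.

Lemma hmL : 3 * S ^+ 2 - 4 * S + 4 = mm ^+ 2.
Proof.
transitivity ((3 * s ^+ 2 - 4 * s + 4)%:~R : L); first by ring.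
by rewrite hm; ring.
Qed.

Lemma Fs_splitting_roots : exists r0 r1 r2 r3 w : L,
  [/\ forall x, root FL x = (x \in [:: r0; r1; r2; r3]),
      {subset [:: r0; r1; r2; r3] <= K} &
      forall E : {subfield L}, {subset [:: r0; r1; r2; r3] <= E} -> (K <= E)%VS] /\
  [/\ w ^+ 2 = S ^+ 2 + 2, r0 + r2 = - 2 * (p + q * w), r1 + r3 = - 2 * (p - q * w) &
      r0 * r2 = - (S ^+ 2 + 1 + S * w) /\ r1 * r3 = - (S ^+ 2 + 1 - S * w)].
Proof.
case: hK => rs Frs Krs.
have Fe : FL = \prod_(r <- rs) ('X - r%:P).
  by apply/eqP; rewrite -eqp_monic ?FsL_monic ?monic_prod_XsubC.
have : size rs = 4%N by have := FsL_size; rewrite Fe size_prod_XsubC => -[].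
case: rs => [|a [|b [|c [|d [|]]]]] // in Frs Krs Fe * => _.
have [e1 e2 e3 e4] := vieta4 (etrans (esym (map_Fs _ _)) Fe).
have [r0 [r1 [r2 [r3 [w [im h1 h2 h3 h4]]]]]] :=
  Fs_pairing two_neq0L q_neq0 D_neq0 e1 e2 e3 e4.
exists r0, r1, r2, r3, w; split; split => //.
- by move=> x; rewrite im Fe root_prod_XsubC.
- by move=> x; rewrite im -Krs; exact: seqv_sub_adjoin.
move=> E sE; rewrite -Krs; apply/Fadjoin_seqP; split; first exact: sub1v.
by move=> x; rewrite -im; exact: sE.
Qed.

Lemma Fs_galois : galois 1 K.
Proof.
apply/and3P; split; first exact: sub1v.
  apply/separableP => y _; apply: pcharf0_separable.
  by move=> n; rewrite pchar_lalg; exact: pchar_num.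
by apply/splitting_normalField; [exact: sub1v | exists FL => //; exact: alg_polyOver].
Qed.

Lemma w_notin1 (w : L) : w ^+ 2 = S ^+ 2 + 2 -> w \notin 1%VS.
Proof.
move=> w2; apply/negP => /vlineP[a aw]; have := rat_sqr_neq s a; rewrite -(inj_eq (fmorph_inj (in_alg L))).
by rewrite rmorphXn rmorphD rmorphXn rmorph_int rmorph_nat /= -aw w2 eqxx.
Qed.

(** With t and t' half the differences of the paired roots, (t t')^2 = m^2 D, so t t' = +-m w. As g
    changes the sign of w, it acts as t -> +-t' -> -t, which has order 4. *)
Lemma Fs_gal_generator : exists (g : gal_of K) (r w : L),
  [/\ ('Gal(K / 1%VS) = <[g]>)%g, #[g]%g = 4%N, r \in K & w \in K] /\
  [/\ w ^+ 2 = S ^+ 2 + 2, g w = - w, r * g (g r) = - (S ^+ 2 + 1 + S * w) &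
      r + g (g r) = - 2 * (p + q * w)] /\
  [/\ forall x, root FL x = (x \in [:: r; g r; g (g r); g (g (g r))]),
      uniq [:: r; g r; g (g r); g (g (g r))] & g (g (g (g r))) = r].
Proof.
have [r0 [r1 [r2 [r3 [w [[rF rK Kr] [w2 t02 t13 [n02 n13]]]]]]]] := Fs_splitting_roots.
have [k0 k1 k2 k3] : [/\ r0 \in K, r1 \in K, r2 \in K & r3 \in K].
  by split; apply: rK; rewrite !inE eqxx ?orbT.
have two0 := two_neq0L; have q0 := q_neq0; have m0 := m_neq0.
have intK (n : int) : (n%:~R : L) \in K by rewrite rpred_int.
have pE : p = (s ^+ 3 - s ^+ 2 + 2 * s - 1)%:~R by ring.
have qE : q = (s ^+ 2 - s + 1)%:~R by ring.
have SK : S \in K by exact: intK.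
have wE : w = - (r0 + r2 + 2 * p) / (2 * q) by rewrite t02; field; rewrite two0 q0.
have pK : p \in K by rewrite pE.
have qK : q \in K by rewrite qE.
have wK : w \in K.
  by rewrite wE rpred_div // ?rpredN ?rpredD // rpredM // rpred_nat.
have w0 : w != 0 by apply: contra D_neq0 => /eqP w0; rewrite -w2 w0 expr0n.
pose t := r0 + p + q * w; pose t' := r1 + p - q * w.
have r0E : r0 = t - (p + q * w) by rewrite /t; ring.
have r2E : r2 = - t - (p + q * w).
  have -> : r2 = (r0 + r2) - r0 by ring.
  by rewrite t02 /t; ring.
have r1E : r1 = t' - (p - q * w) by rewrite /t'; ring.
have r3E : r3 = - t' - (p - q * w).
  have -> : r3 = (r1 + r3) - r1 by ring.
  by rewrite t13 /t'; ring.
have t2 : t ^+ 2 = (p + q * w) ^+ 2 + (S ^+ 2 + 1 + S * w).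
  move: n02; rewrite {1}r0E r2E => h.
  transitivity ((p + q * w) ^+ 2 - (t - (p + q * w)) * (- t - (p + q * w))); first by ring.
  by rewrite h; ring.
have t'2 : t' ^+ 2 = (p - q * w) ^+ 2 + (S ^+ 2 + 1 - S * w).
  move: n13; rewrite {1}r1E r3E => h.
  transitivity ((p - q * w) ^+ 2 - (t' - (p - q * w)) * (- t' - (p - q * w))); first by ring.
  by rewrite h; ring.
have tt2 : (t * t') ^+ 2 = (mm * w) ^+ 2.
  rewrite !exprMn t2 t'2 -hmL w2.
  have -> : (p - q * w) ^+ 2 + (S ^+ 2 + 1 - S * w) =
    p ^+ 2 + q ^+ 2 * w ^+ 2 + S ^+ 2 + 1 - (2 * p * q + S) * w by ring.
  have -> : (p + q * w) ^+ 2 + (S ^+ 2 + 1 + S * w) =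
    p ^+ 2 + q ^+ 2 * w ^+ 2 + S ^+ 2 + 1 + (2 * p * q + S) * w by ring.
  rewrite w2.
  transitivity ((p ^+ 2 + q ^+ 2 * (S ^+ 2 + 2) + S ^+ 2 + 1) ^+ 2 - (2 * p * q + S) ^+ 2 * w ^+ 2).
    by ring.
  by rewrite w2; ring.
have [u [u1 ttE]] : exists u : L, u ^+ 2 = 1 /\ t * t' = u * (mm * w).
  move/eqP: tt2; rewrite eqf_sqr => /orP[]/eqP h; [exists 1 | exists (-1)].
    by rewrite expr1n mul1r.
  by rewrite sqrrN expr1n mulN1r.
have u0 : u != 0 by apply/eqP => u0; move/eqP: u1; rewrite u0 expr0n /= eq_sym oner_eq0.
have tt0 : t * t' != 0 by rewrite ttE !mulf_neq0.
have [t0 t'0] : t != 0 /\ t' != 0 by move: tt0; rewrite mulf_eq0 negb_or => /andP.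
have tK : t \in K by apply: rpredD; [exact: rpredD | exact: rpredM].
(* The field is generated by w and t: t' is +-m w / t, and all four roots are expressed through w, t
   and t'. *)
have fix1 (h : gal_of K) : h w = w -> h t = t -> h = 1%g.
  move=> hw ht.
  have hD x y : h (x + y) = h x + h y by exact: rmorphD.
  have hB x y : h (x - y) = h x - h y by exact: rmorphB.
  have hN x : h (- x) = - h x by exact: rmorphN.
  have hM x y : h (x * y) = h x * h y by exact: rmorphM.
  have hm' : h mm = mm by rewrite rmorph_int.
  have hu : h u = u.
    move/eqP: u1; rewrite -[X in _ == X](expr1n _ 2) eqf_sqr => /orP[]/eqP->; by rewrite ?rmorphN rmorph1.
  have hp : h p = p by rewrite pE rmorph_int.
  have hq : h q = q by rewrite qE rmorph_int.
  have ht' : h t' = t'.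
    have htt : h (t * t') = t * t' by rewrite ttE !hM hu hm' hw.
    by apply: (mulfI t0); rewrite -[RHS]htt hM ht.
  have hb : h (p + q * w) = p + q * w by rewrite hD hM hp hq hw.
  have hb' : h (p - q * w) = p - q * w by rewrite hB hM hp hq hw.
  have sub : (K <= fixedField [set h])%VS.
    apply: Kr => x; rewrite !inE => /or4P[]/eqP->; apply/fixedFieldP => // k /set1P ->.
    - by rewrite r0E hB ht hb.
    - by rewrite r1E hB ht' hb'.
    - by rewrite r2E hB hN ht hb.
    - by rewrite r3E hB hN ht' hb'.
  apply/eqP/gal_eqP => x /(subvP sub) /mem_fixedFieldP[_ /(_ h (set11 h)) ->].
  by rewrite gal_id.
have [g gG gw] : exists2 g : gal_of K, g \in ('Gal(K / 1%VS))%g & g w = - w.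
  have : w \notin fixedField ('Gal(K / 1%VS))%g.
    by rewrite (galois_fixedField Fs_galois); exact: w_notin1 w2.
  case: (boolP [exists g in ('Gal(K / 1%VS))%g, g w != w]) => [/exists_inP[g gG gw] _ | /exists_inPn h].
    exists g => //; have /eqP : (g w) ^+ 2 = w ^+ 2.
      by rewrite -rmorphXn w2 rmorphD rmorphXn rmorph_int rmorph_nat.
    by rewrite eqf_sqr (negPf gw) => /eqP.
  by case/negP; apply/fixedFieldP => // k kG; apply/eqP; move: (h k kG); rewrite negbK.
have gD x y : g (x + y) = g x + g y by exact: rmorphD.
have gB x y : g (x - y) = g x - g y by exact: rmorphB.
have gN x : g (- x) = - g x by exact: rmorphN.
have gM x y : g (x * y) = g x * g y by exact: rmorphM.
have gp : g p = p by rewrite pE rmorph_int.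
have gq : g q = q by rewrite qE rmorph_int.
have gS : g S = S by rewrite rmorph_int.
have gm : g mm = mm by rewrite rmorph_int.
have g1 : g 1 = 1 by exact: rmorph1.
have gX x n : g (x ^+ n) = g x ^+ n by exact: rmorphXn.
have gb : g (p + q * w) = p - q * w by rewrite gD gM gp gq gw mulrN.
have gb' : g (p - q * w) = p + q * w by rewrite gB gM gp gq gw mulrN opprK.
have gee : g (S ^+ 2 + 1 + S * w) = S ^+ 2 + 1 - S * w.
  have eE : S ^+ 2 + 1 = (s ^+ 2 + 1)%:~R by ring.
  by rewrite eE gD gM gw gS mulrN rmorph_int.
have gu : g u = u.
  by move/eqP: u1; rewrite sqrf_eq1 => /orP[]/eqP->; rewrite ?gN g1.
have [e [e1 ge gt]] : exists e : L, [/\ e ^+ 2 = 1, g e = e & g t = e * t'].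
  have /eqP : (g t) ^+ 2 = t' ^+ 2.
    by rewrite -gX t2 t'2 gD gX gb gee.
  rewrite eqf_sqr => /orP[]/eqP ->; [exists 1 | exists (-1)].
    by rewrite expr1n mul1r.
  by rewrite sqrrN expr1n gN g1 mulN1r.
(* The sign is forced by g (t t') = - t t'. *)
have gt' : g t' = - e * t.
  apply: (mulfI (_ : e * t' != 0)).
    by rewrite mulf_neq0 //; apply/eqP => e0; move/eqP: e1; rewrite e0 expr0n /= eq_sym oner_eq0.
  rewrite -{1}gt -gM ttE !gM gu gm gw.
  transitivity (- (e ^+ 2 * (t * t'))); last by ring.
  by rewrite e1 ttE; ring.
have ggw : g (g w) = w by rewrite gw gN gw opprK.
have ggt : g (g t) = - t.
  by rewrite gt gM ge gt'; transitivity (- (e ^+ 2 * t)); [ring | rewrite e1 mul1r].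
have ggt' : g (g t') = - t'.
  by rewrite gt' gM gN ge gt; transitivity (- (e ^+ 2 * t')); [ring | rewrite e1 mul1r].
have gr0 : g r0 = e * t' - (p - q * w) by rewrite r0E gB gt gb.
have ggr0 : g (g r0) = r2.
  by rewrite gr0 gB gb' gM ge gt' r2E; transitivity (- (e ^+ 2 * t) - (p + q * w)); [ring | rewrite e1 mul1r].
have gggr0 : g (g (g r0)) = - e * t' - (p - q * w).
  by rewrite ggr0 r2E gB gN gt gb mulNr.
have g4r0 : g (g (g (g r0))) = r0.
  by rewrite ggr0 r2E !gB !gN ggt gb gb' opprK r0E.
have gk (x : L) : x \in K -> g x \in K by exact: memv_gal.
have g2E x : x \in K -> (g ^+ 2)%g x = g (g x) by move=> xK; rewrite expgS expg1 galM.
have g4E x : x \in K -> (g ^+ 4)%g x = g (g (g (g x))).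
  by move=> xK; rewrite -[4%N]/(2 * 2)%N expgM expgS expg1 galM ?g2E ?gk.
have g4 : (g ^+ 4 = 1)%g.
  by apply: fix1; rewrite g4E // ?ggw ?ggw // ggt !gN ggt opprK.
have g2 : (g ^+ 2)%g t = - t by rewrite g2E.
have ntt : - t != t.
  by rewrite -subr_eq0 -opprD oppr_eq0 -mulr2n -mulr_natl mulf_neq0.
have og : #[g]%g = 4%N.
  have : (#[g]%g %| 2 ^ 2)%N by rewrite order_dvdn; apply/eqP.
  case/(dvdn_pfactor _ _ (isT : prime 2)) => k; case: k => [|[|[|k]]] // _ ok; exfalso.
    have : (g ^+ 2 = 1)%g by apply/eqP; rewrite -order_dvdn ok.
    by move=> gg; move: g2 ntt; rewrite gg gal_id => <-; rewrite eqxx.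
  have : (g ^+ 2 = 1)%g by apply/eqP; rewrite -order_dvdn ok.
  by move=> gg; move: g2 ntt; rewrite gg gal_id => <-; rewrite eqxx.
(* Such an h sends t to t or -t, hence is the identity or the inverse of g^2. *)
have fixw (h : gal_of K) : h w = w -> h \in <[g]>%g.
  move=> hw; have hN x : h (- x) = - h x by exact: rmorphN.
  have hD x y : h (x + y) = h x + h y by exact: rmorphD.
  have hM x y : h (x * y) = h x * h y by exact: rmorphM.
  have : (h t) ^+ 2 == t ^+ 2.
    have hX x n : h (x ^+ n) = h x ^+ n by exact: rmorphXn.
    have hp : h p = p by rewrite pE rmorph_int.
    have hq : h q = q by rewrite qE rmorph_int.
    have hS : h S = S by rewrite rmorph_int.
    have eE : S ^+ 2 + 1 = (s ^+ 2 + 1)%:~R by ring.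
    by rewrite -hX t2 eE hD hX hD hM hp hq hw hD hM hS hw rmorph_int.
  rewrite eqf_sqr => /orP[]/eqP ht; first by rewrite (fix1 h) ?group1.
  have : (h * g ^+ 2 = 1)%g.
    apply: fix1; rewrite galM //; first by rewrite hw g2E.
    by rewrite ht g2E ?rpredN // !gN ggt opprK.
  by move/(canRL (mulgK _)); rewrite mul1g => ->; rewrite groupV groupX ?cycle_id.
have GE : ('Gal(K / 1%VS) = <[g]>)%g.
  apply/eqP; rewrite eqEsubset cycle_subG gG andbT; apply/subsetP => h hG.
  have /eqP : (h w) ^+ 2 = w ^+ 2.
    have -> : (h w) ^+ 2 = h (w ^+ 2) by rewrite rmorphXn.
    by rewrite w2 rmorphD rmorphXn rmorph_int rmorph_nat.
  rewrite eqf_sqr => /orP[]/eqP hw; first exact: fixw.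
  have : (h * g)%g \in <[g]>%g by apply: fixw; rewrite galM // hw gN gw opprK.
  by rewrite groupMr ?cycle_id.
have gr0_neq : g (g r0) != r0.
  by rewrite ggr0 r2E r0E; apply: contra ntt => /eqP /addIr ->.
have ginj x y : g x = g y -> x = y by exact: fmorph_inj.
exists g, r0, w; split; first by split.
split; first by split=> //; rewrite ggr0.
split=> //.
- move=> x; rewrite rF gggr0 ggr0 gr0 !inE r1E r3E.
  move/eqP: e1; rewrite sqrf_eq1 => /orP[]/eqP ->; rewrite ?opprK ?mulN1r ?mul1r //.
  by rewrite orbCA [in RHS]orbC -!orbA; do 4 case: (x == _).
have n1 : g r0 != r0 by apply: contra gr0_neq => /eqP h; rewrite !h.
rewrite /= !inE !negb_or andbT ![r0 == _]eq_sym n1 gr0_neq /=.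
have n3 : g (g (g r0)) != r0 by apply: contra n1 => /eqP h; rewrite -{1}h g4r0.
have n4 : g r0 != g (g r0) by apply: contra n1 => /eqP /ginj <-.
have n5 : g r0 != g (g (g r0)) by apply: contra gr0_neq => /eqP /ginj <-.
have n6 : g (g r0) != g (g (g r0)) by apply: contra n4 => /eqP /ginj <-.
by rewrite n3 n4 n5 n6.
Qed.
End FsGalois.

Lemma Fs_root_integral (L : splittingFieldType rat) (s : int) (x : L) :
  root (map_poly (in_alg L) (Fs s)) x -> integralOver (intr : int -> L) x.
Proof.
move=> rx; apply: (integral_root_monic (FsL_monic s L) rx).
have [c3 e3] : exists c : int, c%:~R = 4 * s%:~R ^+ 3 - 4 * s%:~R ^+ 2 + 8 * s%:~R - 4 :> L.
  by exists (4 * s ^+ 3 - 4 * s ^+ 2 + 8 * s - 4); ring.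
have [c2 e2] : exists c : int, c%:~R = - 6 * s%:~R ^+ 2 - 6 :> L.
  by exists (- 6 * s ^+ 2 - 6); ring.
apply/integral_poly => i; rewrite map_Fs -e3 -e2.
rewrite !coefD !coefCM !coefXn coefX coefC -[4]/(4%:~R).
have nz (b : bool) : integralOver (intr : int -> L) (b%:R).
  by case: b; [exact: integral1 | exact: integral0].
by do ![apply: integral_add | apply: integral_mul | exact: integral_int | exact: nz |
  case: eqP => _ | exact: integral1 | exact: integral0].
Qed.

(** * Transfer between the subfield as a type of its own and the ambient field *)

Section SubfieldTransfer.
Variables (L : fieldExtType rat) (K : {subfield L}).

Lemma integral_vsval (u : subvs_of K) :
  integralOver (intr : int -> L) (vsval u) -> integralOver (intr : int -> subvs_of K) u.
Proof.
case=> p mp rp; exists p => //; rewrite -(fmorph_root (vsval : {rmorphism subvs_of K -> L})).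
by rewrite -map_poly_comp (eq_map_poly (g := intr)) // => z /=; rewrite rmorph_int.
Qed.

Lemma integral_unit_vsval (u : subvs_of K) :
  integral_unit u <-> int_unit K (vsval u).
Proof.
split=> [[u0 iu iu']|[_ u0 iu iu']].
  split; first exact: subvsP.
  - by rewrite fmorph_eq0.
  - by apply/alg_integerE; exact: (integral_morph (vsval : {rmorphism subvs_of K -> L})).
  - rewrite -(fmorphV (vsval : {rmorphism subvs_of K -> L})); apply/alg_integerE.
    exact: (integral_morph (vsval : {rmorphism subvs_of K -> L})).
split; first by rewrite -(fmorph_eq0 (vsval : {rmorphism subvs_of K -> L})).
- by apply: integral_vsval; apply/alg_integerE.
- apply: integral_vsval; rewrite (fmorphV (vsval : {rmorphism subvs_of K -> L})).
  exact/alg_integerE.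
Qed.

Lemma has_index_vsval (HM : subvs_of K -> Prop) (H : L -> Prop) (n : nat) :
  (forall h, HM h <-> H (vsval h)) ->
  (exists reps : 'I_n -> subvs_of K,
    [/\ forall i, integral_unit (reps i),
        forall u, integral_unit u -> exists i, exists2 h, HM h & u = reps i * h &
        forall i j, (exists2 h, HM h & reps i = reps j * h) -> i = j]) ->
  has_index (int_unit K) H n.
Proof.
move=> HH [reps [h1 h2 h3]]; exists (fun i => vsval (reps i)).
split; first by move=> i; apply/integral_unit_vsval.
split.
  move=> u uu; have uK : u \in K by case: uu.
  have uE : u = vsval (vsproj K u) by rewrite vsprojK.
  have [i [h Hh e]] : exists i, exists2 h, HM h & vsproj K u = reps i * h.
    by apply: h2; apply/integral_unit_vsval; rewrite -uE.
  by exists i, (vsval h); [apply/HH | rewrite uE e].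
move=> i j [h Hh e]; apply: h3.
have r0 : vsval (reps j) != 0 by have /integral_unit_vsval[] := h1 j.
have hE : h = vsval ((reps j)^-1 * reps i).
  by rewrite rmorphM /= (fmorphV (vsval : {rmorphism subvs_of K -> L})) e mulKf.
exists ((reps j)^-1 * reps i); first by apply/HH; rewrite -hE.
by rewrite mulVKf // -(fmorph_eq0 (vsval : {rmorphism subvs_of K -> L})).
Qed.
End SubfieldTransfer.

Section FsUnits.
Variables (s : int) (L : splittingFieldType rat) (K : {subfield L}).
Hypothesis hK : splittingFieldFor 1%VS (map_poly (in_alg L) (Fs s)) K.
Local Notation FL := (map_poly (in_alg L) (Fs s)).

(** Irreducibility of F_s: its four roots are distinct Galois conjugates of r, so the minimal
    polynomial already has degree 4. *)
Lemma Fs_minPoly (g : gal_of K) (r : L) : g \in ('Gal(K / 1%VS))%g -> r \in K ->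
  uniq [:: r; g r; g (g r); g (g (g r))] -> root FL r -> minPoly 1 r = FL.
Proof.
move=> gG rK un rF; apply/eqP; rewrite -eqp_monic ?monic_minPoly ?FsL_monic //.
have dv : minPoly 1 r %| FL by apply: minPoly_dvdp => //; exact: alg_polyOver.
rewrite -(dvdp_size_eqp dv); apply/eqP/anti_leq.
rewrite dvdp_leq ?monic_neq0 ?FsL_monic //= FsL_size.
apply: (max_poly_roots _ _ un); first by rewrite monic_neq0 ?monic_minPoly.
have rt k : k \in ('Gal(K / 1%VS))%g -> root (minPoly 1 r) (k r).
  by move=> kG; apply: root_minPoly_gal => //; exact: sub1v.
have gk (x : L) : x \in K -> g x \in K by exact: memv_gal.
rewrite /= root_minPoly rt //= andbT.
have -> : g (g r) = (g * g)%g r by rewrite galM.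
have -> : g ((g * g)%g r) = (g * g * g)%g r by rewrite (galM (g * g)%g g rK).
by rewrite !rt // !groupM.
Qed.

Lemma Fs_Fadjoin (r : L) : #|('Gal(K / 1%VS))%g| = 4%N -> r \in K ->
  minPoly 1 r = FL -> {subset K <= <<1; r>>%VS}.
Proof.
move=> G4 rK mF; have sub : (<<1; r>> <= K)%VS by rewrite sub_adjoin1v.
suff /eqP <- : (<<1; r>>%VS == K) by [].
rewrite eqEdim sub dim_Fadjoin dimv1 muln1.
have := galois_dim (Fs_galois hK); rewrite dimv1 divn1 G4 => ->.
suff -> : adjoin_degree 1 r = 4%N by [].
by apply: succn_inj; rewrite -size_minPoly mF FsL_size.
Qed.

(** Equality of squares is equality up to the generator -1. Only membership in [rs] matters, so the
    roots may be listed in any order. *)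
Lemma root_group_gens (g : gal_of K) (r : L) (rK : r \in K) (r0 : r != 0) (rs : seq L) :
  rs =i [:: r; g r; g (g r); g (g (g r))] ->
  forall h : subvs_of K,
  root_group (gal_restr_rmorphism g) (vsproj K r) h <-> in_gen_group (-1 :: rs) (vsval h).
Proof.
move=> rsE h.
have g0 (x : L) : x != 0 -> g x != 0 by rewrite fmorph_eq0.
have v0 : vsval (vsproj K r) = r by rewrite vsprojK.
have nz : 0 \notin -1 :: rs.
  rewrite inE negb_or eq_sym oppr_eq0 oner_eq0 /= rsE !inE !negb_or.
  by rewrite ![0 == _]eq_sym r0 !g0.
have gE (v : subvs_of K) : vsval (gal_restr_rmorphism g v) = g (vsval v) by exact: gal_restrE.
have vE (a b c d : int) : vsval (vsproj K r ^ a * gal_restr_rmorphism g (vsproj K r) ^ b *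
    gal_restr_rmorphism g (gal_restr_rmorphism g (vsproj K r)) ^ c *
    gal_restr_rmorphism g (gal_restr_rmorphism g (gal_restr_rmorphism g (vsproj K r))) ^ d) =
   r ^ a * g r ^ b * g (g r) ^ c * g (g (g r)) ^ d.
  pose f : {rmorphism subvs_of K -> L} := vsval.
  by rewrite -/(f _) !rmorphM !fmorphXz /f /= !gE v0.
have fX (v : subvs_of K) : vsval (v ^+ 2) = vsval v ^+ 2.
  exact: (rmorphXn (vsval : {rmorphism subvs_of K -> L})).
split.
  case=> a [b [c [d /(congr1 vsval)]]]; rewrite !fX vE.
  have Pin : in_gen_group (-1 :: rs) (r ^ a * g r ^ b * g (g r) ^ c * g (g (g r)) ^ d).
    by do 3 ?[apply: in_gen_groupM => //]; apply: in_gen_groupX => //; apply: mem_in_gen_group;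
      rewrite inE rsE !inE eqxx ?orbT.
  move/eqP; rewrite eqf_sqr => /orP[]/eqP -> //.
  rewrite -[X in in_gen_group _ X]mulN1r.
  by apply: in_gen_groupM => //; apply: mem_in_gen_group; rewrite ?inE ?eqxx.
move=> hin.
suff [a [b [c [d e]]]] : exists a b c d : int,
    vsval h ^+ 2 = (r ^ a * g r ^ b * g (g r) ^ c * g (g (g r)) ^ d) ^+ 2.
  have vinj : injective (vsval : subvs_of K -> L) by exact: val_inj.
  by exists a, b, c, d; apply: vinj; rewrite !fX vE.
have [r1 r2 r3] : [/\ g r != 0, g (g r) != 0 & g (g (g r)) != 0] by split; rewrite !g0.
elim/in_gen_group_ind: hin.
- by exists 0, 0, 0, 0; rewrite !expr0z !mulr1.
- move=> x y [a [b [c [d ex]]]] [a' [b' [c' [d' ey]]]].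
  exists (a + a'), (b + b'), (c + c'), (d + d'); rewrite exprMn ex ey -exprMn !expfzDr //.
  by congr (_ ^+ 2); ring.
move=> x n; rewrite inE rsE !inE => /orP[/eqP ->|/or4P[]/eqP ->].
- exists 0, 0, 0, 0; rewrite !expr0z !mulr1 expr1n.
  by rewrite (exprzAC (-1 : L) n 2 : ((-1) ^ n) ^+ 2 = _) -exprnP sqrrN expr1n exp1rz.
- by exists n, 0, 0, 0; rewrite !expr0z !mulr1.
- by exists 0, n, 0, 0; rewrite !expr0z !mulr1 mul1r.
- by exists 0, 0, n, 0; rewrite !expr0z !mulr1 !mul1r.
- by exists 0, 0, 0, n; rewrite !expr0z !mulr1 !mul1r.
Qed.

End FsUnits.

Unset Implicit Arguments.
Theorem theorem1 (s : int)
  (hsq : exists m : int, 3 * s ^+ 2 - 4 * s + 4 = m ^+ 2)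
  (L : splittingFieldType rat) (K : {subfield L})
  (hK : splittingFieldFor 1%VS (map_poly (in_alg L) (Fs s)) K) :
  (cyclic ('Gal(K / 1%VS))%g /\ #|('Gal(K / 1%VS))%g| = 4%N) /\
  (squarefree (absz (s ^+ 2 + 2)) -> s != 0 ->
   forall rs : seq L,
     map_poly (in_alg L) (Fs s) = \prod_(r <- rs) ('X - r%:P) ->
     has_index (int_unit K) (in_gen_group (-1 :: rs)) 1 \/
     has_index (int_unit K) (in_gen_group (-1 :: rs)) 5).
Proof.
case: hsq => m hm.
have [g [r [w [[GE og rK wK] [[w2 gw nr tr] [rF un g4]]]]]] := Fs_gal_generator hm hK.
have G4 : #|('Gal(K / 1%VS))%g| = 4%N by rewrite GE -orderE.
split; first by rewrite GE cycle_cyclic -orderE.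
move=> sqf s0 rs Frs.
have gG : g \in ('Gal(K / 1%VS))%g by rewrite GE cycle_id.
have rFr : root (map_poly (in_alg L) (Fs s)) r by rewrite rF inE eqxx.
have mF := Fs_minPoly gG rK un rFr.
have sub := Fs_Fadjoin hK G4 rK mF.
(* The ambient field comes without absolute values; sending r to a real root of F_s supplies those
   on which the logarithms depend. *)
have [t Ft] := Fs_real_root Rdefinitions.R s.
pose phi := embedding_rmorphism sub mF Ft.
pose sg := gal_restr_rmorphism g.
pose f : {rmorphism subvs_of K -> L} := vsval.
have finj : injective f by exact: fmorph_inj.
have fsg v : f (sg v) = g (f v) by exact: gal_restrE.
have fw : f (vsproj K w) = w by exact: vsprojK.
have fr : f (vsproj K r) = r by exact: vsprojK.
have r0 : r != 0.
  apply/eqP => r0; move/eqP: rFr; rewrite r0 map_Fs horner_quartic !expr0n /= !mulr0 !add0r.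
  by move/eqP; rewrite oner_eq0.
have gfix v : f v \in K by exact: subvsP.
have sg4 v : sg (sg (sg (sg v))) = v.
  apply: finj; rewrite !fsg.
  have gk (x : L) : x \in K -> g x \in K by exact: memv_gal.
  have e : (g ^+ 4 = 1)%g by rewrite -og expg_order.
  have k0 := gfix v; have k1 := gk _ k0; have k2 := gk _ k1.
  by rewrite -[RHS](gal_id K) -e !expgS expg0 mulg1 !galM.
have fixQ v : sg v = v -> exists a : rat, v = ratr a.
  move=> sv; have : f v \in fixedField ('Gal(K / 1%VS))%g.
    have k0 := gfix v; apply/fixedFieldP => // k; rewrite GE => /cycleP[n ->].
    have gv : g (f v) = f v by rewrite -fsg sv.
    elim: n => [|n ih]; first by rewrite expg0 gal_id.
    by rewrite expgS galM // gv.
  rewrite (galois_fixedField (Fs_galois hK)) => /vlineP[a fa]; exists a.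
  by apply: finj; rewrite fmorph_rat -in_alg_ratr.
have fS : f s%:~R = s%:~R by exact: rmorph_int.
have wM : (vsproj K w) ^+ 2 = s%:~R ^+ 2 + 2.
  by apply: finj; rewrite (rmorphXn f) (rmorphD f) (rmorphXn f) (rmorph_nat f) fw fS w2.
have sgw : sg (vsproj K w) = - vsproj K w.
  by apply: finj; rewrite fsg (rmorphN f) fw gw.
have rint : integralOver (intr : int -> subvs_of K) (vsproj K r).
  by apply: integral_vsval; rewrite [vsval _]fr; exact: Fs_root_integral rFr.
have nM : vsproj K r * sg (sg (vsproj K r)) = - eps0 s (vsproj K w).
  apply: finj; rewrite (rmorphM f) (rmorphN f) !fsg fr nr /eps0.
  by rewrite !(rmorphD f) (rmorphXn f) (rmorphM f) (rmorph1 f) fS fw.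
have tM : vsproj K r + sg (sg (vsproj K r)) = - 2 * ((s%:~R ^+ 3 - s%:~R ^+ 2 + 2 * s%:~R - 1)
    + (s%:~R ^+ 2 - s%:~R + 1) * vsproj K w).
  apply: finj; rewrite (rmorphD f) !fsg fr tr (rmorphM f) (rmorphD f) (rmorphM f) fw.
  have fi (n : int) : f n%:~R = n%:~R by exact: rmorph_int.
  have e1 (F : fieldType) : (s%:~R ^+ 3 - s%:~R ^+ 2 + 2 * s%:~R - 1 : F) = (s ^+ 3 - s ^+ 2 + 2 * s - 1)%:~R by ring.
  have e2 (F : fieldType) : (s%:~R ^+ 2 - s%:~R + 1 : F) = (s ^+ 2 - s + 1)%:~R by ring.
  by rewrite !e1 !e2 !fi -[- 2 : subvs_of K]/((- 2)%:~R) fi.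
have [n [n15 hidx]] := unit_index phi sg4 fixQ wM sgw s0 hm sqf rint nM tM.
have rsE : rs =i [:: r; g r; g (g r); g (g (g r))].
  by move=> x; rewrite -rF Frs root_prod_XsubC.
have := has_index_vsval (root_group_gens rK r0 rsE) hidx.
by case: n15 => ->; [left | right].
Qed.
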